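(* Let $\Gamma$ be a finite simple graph, and for each vertex $v \in V(\Gamma)$ let $(\mathbf{H}(v),X(v))$ be a rational pair with small centralisers, where each $\mathbf{H}(v)$ is a non-trivial group. Let $G(\Gamma,\mathbf{H})$ be the associated graph product, suppose that $G(\Gamma,\mathbf{H})$ has exponential growth, and let $X = \bigsqcup_{v \in V(\Gamma)} X(v)$. Then $$\operatorname{dc}_{X}(G(\Gamma,\mathbf{H})) = 0.$$
   Context: Word length and balls: for a group $G$ with finite generating set $X$, $|g|_X$ is the minimal length of a word over $X\cup X^{-1}$ representing $g$; $B_{G,X}(n)=\{g\in G \mid |g|_X\le n\}$ and $S_{G,X}(n)=\{g\in G\mid |g|_X=n\}$; the spherical growth series is $s_{G,X}(t)=\sum_{n\ge 0}|S_{G,X}(n)|t^n$. $G$ has exponential growth if $\liminf_{n\to\infty}\frac{\log|B_{G,X}(n)|}{n}>0$ (this does not depend on the finite generating set $X$). $C_G(g)$ denotes the centraliser of $g$ in $G$. Degree of commutativity: for a group $G$ with finite generating set $X$, $$\operatorname{dc}_X(G) = \limsup_{n \to \infty} \frac{|\{(x,y) \in B_{G,X}(n)^2 \mid [x,y] = 1\}|}{|B_{G,X}(n)|^2}.$$ Rational pair with small centralisers: a pair $(G,X)$, with $G$ a group and $X$ a finite generating set of $G$, such that (i) $s_{G,X}(t)$ is a rational function (a ratio of two polynomials); and (ii) there exist constants $P,\beta \in \mathbb{Z}_{\geq 1}$ such that $|C_G(g) \cap B_{G,X}(n)| \leq P n^\beta$ for all $n \geq 1$ and all non-trivial $g \in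 G$. Graph product: given a finite simple (undirected) graph $\Gamma$ and a non-trivial group $\mathbf{H}(v)$ for each $v\in V(\Gamma)$, $G(\Gamma,\mathbf{H})$ is the quotient of the free product $\ast_{v\in V(\Gamma)}\mathbf{H}(v)$ by the normal closure of $\{[g,h]\mid g\in\mathbf{H}(v),\ h\in\mathbf{H}(w),\ \{v,w\}\in E(\Gamma)\}$. Each $\mathbf{H}(v)$ embeds in $G(\Gamma,\mathbf{H})$, and $X$ is regarded as a generating set of $G(\Gamma,\mathbf{H})$. *)

(* Defs.v *)
From HB Require Import structures.
From mathcomp Require Import all_boot all_order all_algebra finmap.
From mathcomp Require Import all_classical all_reals all_analysis.

Set Implicit Arguments.
Unset Strict Implicit.
Unset Printing Implicit Defensive.

Import Order.TTheory GRing.Theory Num.Theory.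

Local Open Scope classical_set_scope.
Local Open Scope quotient_scope.
Local Open Scope group_scope.

Section NormalClosure.
Variable G : groupType.

Definition normal_subgroup (N : set G) : Prop :=
  [/\ N 1, forall x y, N x -> N y -> N (x * y), forall x, N x -> N x^-1
    & forall x y, N x -> N (x ^ y)].

Definition normal_closure (S : set G) : set G :=
  [set x | forall N : set G, normal_subgroup N -> S `<=` N -> N x].

Lemma normal_closureP S : normal_subgroup (normal_closure S).
Proof.
split=> [|x y Sx Sy N nN SN|x Sx N nN SN|x y Sx N nN SN].
- by move=> N [].
- by case: (nN) => _ NM _ _; exact: NM (Sx N nN SN) (Sy N nN SN).
- by case: (nN) => _ _ NV _; exact: NV (Sx N nN SN).
- by case: (nN) => _ _ _ NJ; exact: NJ (Sx N nN SN).
Qed.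

Variable S : set G.

Definition ncl_rel (x y : G) : bool := `[< normal_closure S (x^-1 * y) >].

Lemma ncl_rel_refl : reflexive ncl_rel.
Proof. by move=> x; apply/asboolP; rewrite mulVg; case: (normal_closureP S). Qed.

Lemma ncl_rel_impl x y : ncl_rel x y -> ncl_rel y x.
Proof.
move=> /asboolP xy; apply/asboolP; case: (normal_closureP S) => _ _ NV _.
by have := NV _ xy; rewrite invgM invgK.
Qed.

Lemma ncl_rel_sym : symmetric ncl_rel.
Proof. by move=> x y; apply/idP/idP; exact: ncl_rel_impl. Qed.

Lemma ncl_rel_trans : transitive ncl_rel.
Proof.
move=> y x z /asboolP xy /asboolP yz; apply/asboolP.
case: (normal_closureP S) => _ NM _ _.
by have := NM _ _ xy yz; rewrite mulgA mulgK.
Qed.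

Canonical ncl_equiv := EquivRel ncl_rel ncl_rel_refl ncl_rel_sym ncl_rel_trans.

Definition ncl_quotient := {eq_quot ncl_equiv}.
HB.instance Definition _ := Choice.on ncl_quotient.
HB.instance Definition _ := EqQuotient.on ncl_quotient.

Definition ncl_pi (x : G) : ncl_quotient := \pi x.

Lemma ncl_piP x y : ncl_pi x = ncl_pi y <-> normal_closure S (x^-1 * y).
Proof.
split; first by move=> /eqmodP/asboolP.
by move=> xy; apply/eqmodP/asboolP.
Qed.

Definition nclq_one : ncl_quotient := ncl_pi 1.
Definition nclq_mul (a b : ncl_quotient) := ncl_pi (repr a * repr b).
Definition nclq_inv (a : ncl_quotient) := ncl_pi (repr a)^-1.

Lemma ncl_repr x : normal_closure S (x^-1 * repr (ncl_pi x)).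
Proof. by apply/ncl_piP; rewrite /ncl_pi reprK. Qed.

Lemma nclq_mulE x y : nclq_mul (ncl_pi x) (ncl_pi y) = ncl_pi (x * y).
Proof.
apply/esym/ncl_piP; case: (normal_closureP S) => _ NM _ NJ.
have := NM _ _ (NJ _ y (ncl_repr x)) (ncl_repr y).
by rewrite /conjg !mulgA mulgK invgM.
Qed.

Lemma nclq_invE x : nclq_inv (ncl_pi x) = ncl_pi x^-1.
Proof.
apply/ncl_piP; case: (normal_closureP S) => _ _ _ NJ.
rewrite invgK; have := NJ _ x^-1 (ncl_repr x).
by rewrite /conjg invgK !mulgA mulgV mul1g.
Qed.

Lemma nclq_ind (P : ncl_quotient -> Prop) :
  (forall x, P (ncl_pi x)) -> forall a, P a.
Proof. by move=> Ppi a; rewrite -[a]reprK; exact: Ppi. Qed.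

Lemma nclq_mulA : associative nclq_mul.
Proof.
elim/nclq_ind=> x; elim/nclq_ind=> y; elim/nclq_ind=> z.
by rewrite !nclq_mulE mulgA.
Qed.

Lemma nclq_mul1 : left_id nclq_one nclq_mul.
Proof. by elim/nclq_ind=> x; rewrite nclq_mulE mul1g. Qed.

Lemma nclq_1mul : right_id nclq_one nclq_mul.
Proof. by elim/nclq_ind=> x; rewrite nclq_mulE mulg1. Qed.

Lemma nclq_mulV : left_inverse nclq_one nclq_inv nclq_mul.
Proof. by elim/nclq_ind=> x; rewrite nclq_invE nclq_mulE mulVg. Qed.

Lemma nclq_Vmul : right_inverse nclq_one nclq_inv nclq_mul.
Proof. by elim/nclq_ind=> x; rewrite nclq_invE nclq_mulE mulgV. Qed.

HB.instance Definition _ := isGroup.Build ncl_quotient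
  nclq_mulA nclq_mul1 nclq_1mul nclq_mulV nclq_Vmul.

Lemma ncl_piM : {morph ncl_pi : x y / x * y}.
Proof. by move=> x y; rewrite -nclq_mulE. Qed.

Lemma ncl_pi1 : ncl_pi 1 = 1.
Proof. by []. Qed.

HB.instance Definition _ :=
  isUMagmaMorphism.Build G ncl_quotient ncl_pi (conj ncl_pi1 ncl_piM).

End NormalClosure.

Section FreeProduct.
Variables (V : choiceType) (H : V -> groupType).

Definition syllable := {v : V & H v}.
Definition syl (v : V) (g : H v) : syllable := Tagged (fun v => H v : Type) g.

(* The congruence on words of syllables that identifies (v, 1) with the empty
   word and (v, g)(v, h) with (v, g * h). *)
Inductive fp_eqv : seq syllable -> seq syllable -> Prop :=
| fp_refl s : fp_eqv s s
| fp_sym s t : fp_eqv s t -> fp_eqv t s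
| fp_trans s t u : fp_eqv s t -> fp_eqv t u -> fp_eqv s u
| fp_unit s t v : fp_eqv (s ++ syl (1 : H v) :: t) (s ++ t)
| fp_merge s t v (g h : H v) :
    fp_eqv (s ++ syl g :: syl h :: t) (s ++ syl (g * h) :: t).

Definition fp_rel (s t : seq syllable) : bool := `[< fp_eqv s t >].

Lemma fp_rel_refl : reflexive fp_rel.
Proof. by move=> s; apply/asboolP; exact: fp_refl. Qed.

Lemma fp_rel_sym : symmetric fp_rel.
Proof. by move=> s t; apply/asboolP/asboolP; exact: fp_sym. Qed.

Lemma fp_rel_trans : transitive fp_rel.
Proof. by move=> t s u /asboolP st /asboolP tu; apply/asboolP/(fp_trans st). Qed.

Canonical fp_equiv := EquivRel fp_rel fp_rel_refl fp_rel_sym fp_rel_trans.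

Definition free_product := {eq_quot fp_equiv}.
HB.instance Definition _ := Choice.on free_product.
HB.instance Definition _ := EqQuotient.on free_product.

Definition fp_pi (s : seq syllable) : free_product := \pi s.

Lemma fp_piP s t : fp_pi s = fp_pi t <-> fp_eqv s t.
Proof.
split; first by move=> /eqmodP/asboolP.
by move=> st; apply/eqmodP/asboolP.
Qed.

Definition syl_inv (a : syllable) : syllable := syl (tagged a)^-1.
Definition word_inv (s : seq syllable) : seq syllable := rev (map syl_inv s).

Lemma fp_eqv_cat a b s t : fp_eqv s t -> fp_eqv (a ++ s ++ b) (a ++ t ++ b).
Proof.
elim=> {s t} [s|s t _|s t u _ st _ tu|s t v|s t v g h].
- exact: fp_refl.
- exact: fp_sym.
- exact: fp_trans st tu.
- by rewrite -!catA /= !(catA a s); exact: fp_unit.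
- by rewrite -!catA /= !(catA a s); exact: fp_merge.
Qed.

Lemma fp_eqv_inv s t : fp_eqv s t -> fp_eqv (word_inv s) (word_inv t).
Proof.
have E s' t' : word_inv (s' ++ t') = word_inv t' ++ word_inv s'.
  by rewrite /word_inv map_cat rev_cat.
elim=> {s t} [s|s t _|s t u _ st _ tu|s t v|s t v g h].
- exact: fp_refl.
- exact: fp_sym.
- exact: fp_trans st tu.
- rewrite -cat1s !E -catA /= /word_inv /= /syl_inv /= invg1; exact: fp_unit.
- rewrite -cat1s -(cat1s (syl h)) -(cat1s (syl (g * h))) !E -!catA /=.
  by rewrite /word_inv /= /syl_inv /= invgM; exact: fp_merge.
Qed.

Lemma fp_eqv_invl s : fp_eqv (word_inv s ++ s) [::].
Proof.
elim: s => [|[v g] s IHs]; first exact: fp_refl.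
have -> : word_inv (existT _ v g :: s) = rcons (word_inv s) (syl g^-1).
  by rewrite /word_inv /= rev_cons.
rewrite cat_rcons; apply: fp_trans IHs.
apply: fp_trans (fp_merge _ _ _ _) _.
rewrite mulVg; exact: fp_unit.
Qed.

Lemma word_invK : involutive word_inv.
Proof.
move=> s; rewrite /word_inv map_rev revK -map_comp -[RHS]map_id.
by apply: eq_map => -[v g] /=; rewrite /syl_inv /= invgK.
Qed.

Definition fp_one : free_product := fp_pi [::].
Definition fp_mul (a b : free_product) := fp_pi (repr a ++ repr b).
Definition fp_inv (a : free_product) := fp_pi (word_inv (repr a)).

Lemma fp_repr s : fp_eqv s (repr (fp_pi s)).
Proof. by apply/fp_piP; rewrite /fp_pi reprK. Qed.

Lemma fp_mulE s t : fp_mul (fp_pi s) (fp_pi t) = fp_pi (s ++ t).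
Proof.
apply/esym/fp_piP; apply: (@fp_trans _ (repr (fp_pi s) ++ t)).
  exact: (fp_eqv_cat [::] t (fp_repr s)).
by have := fp_eqv_cat (repr (fp_pi s)) [::] (fp_repr t); rewrite !cats0.
Qed.

Lemma fp_invE s : fp_inv (fp_pi s) = fp_pi (word_inv s).
Proof. exact/esym/fp_piP/fp_eqv_inv/fp_repr. Qed.

Lemma fp_ind (P : free_product -> Prop) :
  (forall s, P (fp_pi s)) -> forall a, P a.
Proof. by move=> Ppi a; rewrite -[a]reprK; exact: Ppi. Qed.

Lemma fp_mulA : associative fp_mul.
Proof.
elim/fp_ind=> s; elim/fp_ind=> t; elim/fp_ind=> u.
by rewrite !fp_mulE catA.
Qed.

Lemma fp_mul1 : left_id fp_one fp_mul.
Proof. by elim/fp_ind=> s; rewrite fp_mulE. Qed.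

Lemma fp_1mul : right_id fp_one fp_mul.
Proof. by elim/fp_ind=> s; rewrite fp_mulE cats0. Qed.

Lemma fp_mulV : left_inverse fp_one fp_inv fp_mul.
Proof.
by elim/fp_ind=> s; rewrite fp_invE fp_mulE; apply/fp_piP/fp_eqv_invl.
Qed.

Lemma fp_Vmul : right_inverse fp_one fp_inv fp_mul.
Proof.
elim/fp_ind=> s; rewrite fp_invE fp_mulE; apply/fp_piP.
by rewrite -{1}[s]word_invK; exact: fp_eqv_invl.
Qed.

HB.instance Definition _ := isGroup.Build free_product
  fp_mulA fp_mul1 fp_1mul fp_mulV fp_Vmul.

Definition fp_in (v : V) (g : H v) : free_product := fp_pi [:: syl g].

Lemma fp_inM v : {morph @fp_in v : x y / x * y}.
Proof.
move=> x y; rewrite [RHS]fp_mulE.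
exact/esym/fp_piP/(fp_merge [::] [::]).
Qed.

Lemma fp_in1 v : @fp_in v 1 = 1.
Proof. exact/fp_piP/(fp_unit [::] [::]). Qed.

HB.instance Definition _ v := isUMagmaMorphism.Build (H v) free_product
  (@fp_in v) (conj (@fp_in1 v) (@fp_inM v)).

End FreeProduct.

Section GraphProduct.
Variables (V : finType) (e : rel V) (H : V -> groupType).

Definition graph_relators : set (free_product H) :=
  [set r | exists (v w : V) (g : H v) (h : H w),
     e v w /\ r = [~ fp_in g, fp_in h]].

Definition graph_product : groupType := ncl_quotient graph_relators.

Definition gp_in (v : V) (g : H v) : graph_product :=
  ncl_pi graph_relators (fp_in g).

(* The disjoint union of the X v, viewed inside the graph product. *)
Definition gp_gens (X : forall v, set (H v)) : set graph_product :=
  \bigcup_v (@gp_in v @` X v).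

End GraphProduct.

Arguments gp_in {V} e {H v} g.
Arguments gp_gens {V} e {H} X.

Section Growth.
Variables (R : realType) (G : groupType).
Implicit Types (X : set G) (g : G) (n : nat).

Definition represents X (w : seq G) g : Prop :=
  (forall x, x \in w -> X x \/ X x^-1) /\ \prod_(x <- w) x = g.

Definition generates X : Prop := forall g, exists w, represents X w g.

Definition finite_generating_set X : Prop := finite_set X /\ generates X.

(* Meaningful when X generates G; the length is 0 by default when g is not
   represented by any word over X and its inverses. *)
Definition word_length X g : nat :=
  xget 0%N [set n | (exists2 w, represents X w g & size w = n) /\
                    (forall w, represents X w g -> (n <= size w)%N)].

Definition gball X n : set G := [set g | (word_length X g <= n)%N].
Definition gsphere X n : set G := [set g | word_length X g = n].

Definition finite_card (T : choiceType) (A : set T) : nat := #|` fset_set A |.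

Definition centraliser g : set G := [set x | commute g x].

(* Formal power series are represented by their sequences of coefficients. *)
Definition growth_series X : nat -> R :=
  fun n => ((finite_card (gsphere X n))%:R)%R.

Definition fps_mul (s t : nat -> R) : nat -> R :=
  fun n => (\sum_(i < n.+1) s i * t (n - i)%N)%R.

(* s = p / q, that is, q s = p as formal power series; q may vanish at 0. *)
Definition rational_fps (s : nat -> R) : Prop :=
  exists p q : {poly R},
    (q != 0)%R /\ fps_mul (fun n => (q`_n)%R) s = (fun n => (p`_n)%R).

Definition rational_small_centralisers X : Prop :=
  [/\ finite_generating_set X,
      rational_fps (growth_series X)
    & exists P b : nat, [/\ (1 <= P)%N, (1 <= b)%N &
        forall n g, (1 <= n)%N -> g <> 1 ->
          (finite_card (centraliser g `&` gball X n) <= P * n ^ b)%N]].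

(* The lower limit being positive does not depend on the choice of X. *)
Definition exponential_growth : Prop :=
  exists X, finite_generating_set X /\
    (0 < limn_einf (fun n =>
           (ln (finite_card (gball X n))%:R / n%:R : R)%R%:E))%E.

Definition degree_commutativity X : \bar R :=
  limn_esup (fun n =>
    ((finite_card [set xy : G * G | [/\ gball X n xy.1, gball X n xy.2
                                      & [~ xy.1, xy.2] = 1%g]])%:R
       / (finite_card (gball X n) ^ 2)%N%:R : R)%R%:E).

End Growth.

(* Main.v *)
Require Import Defs.
From mathcomp Require Import all_boot all_order all_algebra finmap.
From mathcomp Require Import all_classical all_reals all_analysis.
From mathcomp Require Import zify ring lra.

(** The graph product [G] is the direct product of its subgroups over the connected
    components [U] of the complement of the graph, the word length of [G] is the sum
    of the lengths of the projections to these factors, and two elements commute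
    exactly when their projections do. So the proof has two parts: inside a factor,
    centralisers are negligible; and in the product of the factors, the pairs that
    commute because their projections to each factor are not both long are few.

    For the first part, let [U] be a factor of superpolynomial growth. If [U] is a
    single vertex, then the bound on centralisers in the vertex group applies. In
    general, let [x] be nontrivial. If [x] is conjugate into the subgroup of a proper
    subset of [U], then so is its centraliser ([centraliser_parabolic]). Such parabolic
    subgroups are sparse ([parabolic_sparse]): an element of length [k] can be cut at
    each of [k + 1] places of a geodesic, and the insertion at that place of a fixed
    word, which runs through all of [U] along edges of the complement graph, is
    injective. If [x] lies in no proper parabolic subgroup, then neither do the
    nontrivial elements of its centraliser; such an element fixes no wall, that is,
    no coset of the parabolic subgroup of the star of a vertex; and it moves the walls in
    the middle of a long power of [x] to walls crossed by the same power, so that it is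
    determined by the shift ([centraliser_walls]). This bounds the number of
    elements of length at most [m] in the centraliser by a linear function of [m].

    For the second part, choose [mu > 1] such that some factors have balls of radius [q]
    with at least [mu ^ q] elements for all [q], and call these fast; the other factors
    have growth rates less than [mu]. By the first part we may ignore the commuting
    pairs of which both elements have long projections to the same fast factor. For
    every other commuting pair there is a set [I] of fast factors such that only the
    first element may have long projections to the factors in [I] and only the second
    to the other fast factors. So it must be shown that the two products of the slow
    factors, with the fast factors in [I] and with the others, cannot both have a
    positive proportion of the elements of large balls of [G]. If [A' n] and [B' n] are the
    sizes of their balls, then submultiplicativity turns such a proportion into a bound
    for the sums of [b k / A' k] and [a k / B' k], where [a k] and [b k] are the sizes of the
    spheres of the two products of fast factors. But the terms of the sum of both are
    bounded from below at each time [k] when these two products grow exponentially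
    relative to their past ([growth_balance]).

    All of this rests on the normal forms of Green: elements of [G] are represented by
    reduced words of syllables, uniquely up to shuffling neighbouring syllables at
    adjacent vertices ([reduced_unique]). The main tool derived from them is the front
    of an element at a vertex, the syllable at this vertex that can be shuffled to the
    beginning of a reduced word. *)

Set Implicit Arguments.
Unset Strict Implicit.
Unset Printing Implicit Defensive.

Import Order.TTheory GRing.Theory Num.Theory.
Import numFieldNormedType.Exports.

Local Open Scope classical_set_scope.
Local Open Scope group_scope.


(** * Finite cardinalities *)

Section FiniteCard.
Variables T U : choiceType.
Implicit Types (A : set T) (B : set U).

Lemma card_subset A A' : finite_set A' -> A `<=` A' -> (finite_card A <= finite_card A')%N.
Proof.
move=> fA' AA'; apply: fsubset_leq_card.
by rewrite -fset_set_sub //; exact: sub_finite_set fA'.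
Qed.

Lemma card_injection A B (f : T -> U) : finite_set A -> finite_set B ->
  (forall x, A x -> B (f x)) -> (forall x y, A x -> A y -> f x = f y -> x = y) ->
  (finite_card A <= finite_card B)%N.
Proof.
move=> fA fB AB inj; rewrite /finite_card.
have <- : #|` (f @` fset_set A)%fset| = #|` fset_set A|.
  apply: card_in_imfset => x y /=; rewrite !in_fset_set // !inE; exact: inj.
apply: fsubset_leq_card; apply/fsubsetP => _ /imfsetP[x /= + ->].
by rewrite !in_fset_set // !inE; exact: AB.
Qed.

Lemma card_setX A B : finite_set A -> finite_set B ->
  finite_card (A `*` B) = (finite_card A * finite_card B)%N.
Proof.
move=> fA fB; rewrite /finite_card fset_setX //.
rewrite -(size_allpairs (fun a b => (a, b)) (fset_set A) (fset_set B)).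
apply: perm_size; apply: uniq_perm; first exact: fset_uniq.
  by apply: allpairs_uniq; rewrite ?fset_uniq // => -[? ?] [? ?].
move=> [a b]; rewrite in_fsetM /=; apply/andP/allpairsP => [[aA bB]|[[a' b'] [? ? [-> ->]]]].
  by exists (a, b).
by [].
Qed.

Lemma card_setU A A' : finite_set A -> finite_set A' ->
  (finite_card (A `|` A') <= finite_card A + finite_card A')%N.
Proof.
by move=> fA fA'; rewrite /finite_card fset_setU // cardfsU leq_subr.
Qed.

Lemma card_cover (I : eqType) (r : seq I) (F : I -> set T) A :
  (forall i, finite_set (F i)) -> (forall x, A x -> exists2 i, i \in r & F i x) ->
  (finite_card A <= \sum_(i <- r) finite_card (F i))%N.
Proof.
move=> fF; elim: r A => [|i r IHr] A Ar.
  have -> : A = set0 by rewrite -subset0 => x /Ar[].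
  by rewrite /finite_card fset_set0 cardfs0.
pose A' := [set x | exists2 j, j \in r & F j x].
have fA' : finite_set A'.
  apply: (@sub_finite_set _ _ (\bigcup_(j in [set` r]) F j)).
    by move=> x [j jr Fx]; exists j.
  by apply: bigcup_finite => //; exact: finite_seq.
rewrite big_cons; apply: (@leq_trans (finite_card (F i `|` A'))).
  apply: card_subset => [|x /Ar[j]]; first by rewrite finite_setU.
  by rewrite inE => /predU1P[->|jr] Fx; [left|right; exists j].
apply: leq_trans (card_setU (fF i) fA') _; rewrite leq_add2l; apply: IHr.
by [].
Qed.

Lemma card_slices A (f : T -> nat) n : finite_set A -> (forall x, A x -> (f x <= n)%N) ->
  finite_card A = (\sum_(k < n.+1) finite_card (A `&` [set x | f x = k]))%N.
Proof.
move=> fA fn; rewrite /finite_card card_fset_sum1.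
rewrite [RHS](eq_bigr (fun k : 'I_n.+1 => \sum_(x <- fset_set A) (f x == k))%N).
  rewrite exchange_big /= big_seq [RHS]big_seq; apply: eq_bigr => x.
  rewrite in_fset_set // inE => /fn fxn.
  rewrite (bigD1 (Ordinal (fxn : (f x < n.+1)%N))) //= eqxx big1 ?addn0 // => k.
  by move=> kx; case: eqP => // E; case/eqP: kx; apply: val_inj.
move=> k _; have fk : finite_set (A `&` [set x | f x = k]) by exact: sub_finite_set fA.
have -> : (\sum_(x <- fset_set A) (f x == k) = \sum_(x <- fset_set A | f x == k) 1)%N.
  by rewrite [RHS]big_mkcond; apply: eq_bigr => x _; case: (_ == _).
rewrite card_fset_sum1 -[RHS]big_filter; apply: perm_big.
apply: uniq_perm; rewrite ?filter_uniq ?fset_uniq // => x.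
rewrite mem_filter !in_fset_set //; apply/idP/idP => [|/andP[/eqP fx]].
  by rewrite in_setE => -[Ax fx]; apply/andP; split; [exact/eqP|rewrite in_setE].
by rewrite !in_setE.
Qed.

End FiniteCard.

Lemma card_fibers (T1 T2 : choiceType) (A : set (T1 * T2)) (B : set T1) (K c : nat) :
  finite_set A -> finite_set B -> (forall u, A u -> B u.1) ->
  (forall x, B x -> (K * finite_card [set y | A (x, y)] <= c)%N) ->
  (K * finite_card A <= finite_card B * c)%N.
Proof.
move=> fA fB AB Ac; pose F x : set (T1 * T2) := A `&` [set u | u.1 = x].
have fF x : finite_set (F x) by apply: sub_finite_set fA => u [].
have le : (finite_card A <= \sum_(x <- fset_set B) finite_card (F x))%N.
  apply: card_cover => // u Au; exists u.1 => //.
  by rewrite in_fset_set // in_setE; exact: AB.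
apply: (@leq_trans (\sum_(x <- fset_set B) K * finite_card (F x))%N).
  by rewrite -big_distrr leq_mul2l le orbT.
apply: (@leq_trans (\sum_(x <- fset_set B) c)%N); last first.
  by rewrite big_const_seq count_predT iter_addn_0 mulnC.
rewrite big_seq [X in (_ <= X)%N]big_seq; apply: leq_sum => x.
rewrite in_fset_set // in_setE => /Ac; apply: leq_trans; rewrite leq_mul2l.
apply/orP; right; apply: (@card_injection _ _ _ _ snd) => //.
- apply: (@sub_finite_set _ _ (snd @` A)); last exact: finite_image.
  by move=> y Ay; exists (x, y).
- by move=> [x' y] /= [Axy /= <-].
by move=> [x1 y1] [x2 y2] [_ /= ->] [_ /= ->] ->.
Qed.

(** * Word length *)

Section WordLength.
Variables (G : groupType) (X : set G).
Implicit Types (g h x y : G) (w : seq G).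

Lemma represents_cat w w' g h : represents X w g -> represents X w' h ->
  represents X (w ++ w') (g * h).
Proof.
move=> [Xw Ew] [Xw' Ew']; split; last by rewrite big_cat /= Ew Ew'.
by move=> x; rewrite mem_cat => /orP[/Xw|/Xw'].
Qed.

Lemma represents_inv w g : represents X w g -> represents X (rev (map (fun x => x^-1) w)) g^-1.
Proof.
move=> [Xw <-]; split=> [x|].
  by rewrite mem_rev => /mapP[y /Xw + ->]; rewrite invgK => -[]; [right|left].
elim: w {Xw} => [|x w IHw]; first by rewrite /= !big_nil invg1.
by rewrite /= rev_cons -cats1 big_cat big_seq1 /= IHw big_cons invgM.
Qed.

Hypothesis gen : generates X.

Lemma word_lengthP g :
  (exists2 w, represents X w g & size w = word_length X g) /\
  (forall w, represents X w g -> (word_length X g <= size w)%N).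
Proof.
pose P n := `[< exists2 w, represents X w g & size w = n >].
have exP : exists n, P n.
  by have [w rw] := gen g; exists (size w); apply/asboolP; exists w.
case: (ex_minnP exP) => n /asboolP[w rw sw] minn.
have : [set n | (exists2 w, represents X w g & size w = n) /\
                    (forall w, represents X w g -> (n <= size w)%N)] n.
  by split; [exists w|move=> w' rw'; apply: minn; apply/asboolP; exists w'].
by move=> /xgetI => /(_ 0%N).
Qed.

Lemma word_length_min w g : represents X w g -> (word_length X g <= size w)%N.
Proof. exact: (word_lengthP g).2. Qed.

Lemma word_length1 : word_length X 1 = 0%N.
Proof.
apply/eqP; rewrite -leqn0; apply: (@word_length_min [::]).
by split=> //; rewrite big_nil.
Qed.

Lemma word_lengthM g h : (word_length X (g * h) <= word_length X g + word_length X h)%N.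
Proof.
have [[w rw <-] _] := word_lengthP g; have [[w' rw' <-] _] := word_lengthP h.
by rewrite -size_cat; apply/word_length_min/represents_cat.
Qed.

Lemma word_lengthV g : word_length X g^-1 = word_length X g.
Proof.
have le h : (word_length X h^-1 <= word_length X h)%N.
  have [[w rw <-] _] := word_lengthP h.
  have := word_length_min (represents_inv rw); by rewrite size_rev size_map.
by apply/eqP; rewrite eqn_leq le -{1}[g]invgK le.
Qed.

Lemma word_length_eq0 g : word_length X g = 0%N -> g = 1.
Proof.
have [[w [_ <-] <-] _] := word_lengthP g.
by move=> /size0nil ->; rewrite big_nil.
Qed.

Lemma word_length_gen x : X x \/ X x^-1 -> (word_length X x <= 1)%N.
Proof.
move=> Xx; apply: (@word_length_min [:: x]); split; last by rewrite big_seq1.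
by move=> y; rewrite inE => /eqP ->.
Qed.

Lemma gball_finite n : finite_set X -> finite_set (gball X n).
Proof.
move=> fX; pose Y : set G := [set x | X x \/ X x^-1] `|` [set 1].
have fY : finite_set Y.
  rewrite finite_setU; split; last exact: finite_set1.
  apply: (@sub_finite_set _ _ (X `|` (fun x => x^-1) @` X)).
    by move=> x [Xx|Xx]; [left|right; exists x^-1; rewrite ?invgK].
  by rewrite finite_setU; split=> //; exact: finite_image.
elim: n => [|n IHn].
  apply: (@sub_finite_set _ _ [set 1]); last exact: finite_set1.
  by move=> g; rewrite /gball /= leqn0 => /eqP/word_length_eq0.
apply: sub_finite_set (finite_image2 (fun x y : G => x * y) fY IHn) => g /= gn.
have [[w [Xw Ew] sw] _] := word_lengthP g.
case: w Xw Ew sw => [|x w] Xw Ew sw.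
  exists 1; [by right|exists g; rewrite ?mul1g //].
  by rewrite /gball /= -sw.
exists x; first by left; apply: Xw; exact: mem_head.
exists (\prod_(y <- w) y); last by rewrite -Ew big_cons.
apply: (@leq_trans (size w)).
  by apply: word_length_min; split=> // y yw; apply: Xw; rewrite inE yw orbT.
by rewrite -ltnS; apply: leq_trans gn; rewrite -sw.
Qed.

End WordLength.

(** * Growth of sequences *)

Section Sequences.
Local Open Scope ring_scope.
Variable R : realType.
Implicit Types (x r mu : R) (n k : nat).

Lemma bernoulli x n : 0 <= x -> 1 + n%:R * x <= (1 + x) ^+ n.
Proof.
move=> x0; elim: n => [|n IHn]; first by rewrite mul0r addr0 expr0.
rewrite exprS; apply: le_trans (ler_wpM2l _ IHn); last by rewrite addr_ge0.
by rewrite -natr1; have : 0 <= n%:R :> R by []; nra.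
Qed.

Lemma expr_unbounded mu x : 1 < mu -> exists n, forall m, (n <= m)%N -> x <= mu ^+ m.
Proof.
move=> mu1; have d0 : 0 < mu - 1 by rewrite subr_gt0.
have [n Hn] : exists n : nat, x / (mu - 1) <= n%:R.
  exists (Num.truncn `|x / (mu - 1)|).+1.
  by apply: le_trans (ler_norm _) _; rewrite ltW // truncnS_gt.
exists n => m nm; have {1}-> : mu = 1 + (mu - 1) by rewrite addrC subrK.
apply: le_trans (bernoulli m (ltW d0)).
rewrite ler_pdivrMr // in Hn; apply: le_trans Hn _.
have : n%:R * (mu - 1) <= m%:R * (mu - 1) by rewrite ler_pM2r // ler_nat.
lra.
Qed.

Lemma root_exists x n : 1 <= x -> (0 < n)%N -> exists2 r, 1 <= r & r ^+ n = x.
Proof.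
move=> x1 n0; have x0 : 0 <= x by exact: le_trans x1.
have n0' : n%:R != 0 :> R by rewrite pnatr_eq0 -lt0n.
exists (x `^ (n%:R^-1)).
  by rewrite -[leLHS](powRr0 x); apply: ler_powR; rewrite // invr_ge0.
by rewrite -powR_mulrn ?powR_ge0 // -powRrM mulVf // powRr1.
Qed.

Lemma expr_superpolynomial mu (K b : nat) : 1 < mu ->
  exists L, forall m, (L <= m)%N -> (K * m ^ b)%:R <= mu ^+ m.
Proof.
move=> mu1; have [r r1 Er] := root_exists (ltW mu1) (ltn0Sn b).
have {}r1 : 1 < r.
  by rewrite lt_neqAle r1 andbT; apply: contraTneq mu1 => r1'; rewrite -Er -r1' expr1n ltxx.
have d0 : 0 < r - 1 by rewrite subr_gt0.
have [L HL] : exists L : nat, K%:R / (r - 1) ^+ b.+1 <= L%:R :> R.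
  exists (Num.truncn `|K%:R / (r - 1) ^+ b.+1|).+1.
  by apply: le_trans (ler_norm _) _; rewrite ltW // truncnS_gt.
exists L => m Lm; rewrite -Er exprAC.
have rm : m%:R * (r - 1) <= r ^+ m.
  have E : 1 + (r - 1) = r by lra.
  by have := bernoulli m (ltW d0); rewrite E => h; lra.
have m0 : 0 <= m%:R * (r - 1) by rewrite mulr_ge0 // ltW.
apply: le_trans (lerXn2r b.+1 _ _ rm); rewrite ?nnegrE //; last exact: le_trans rm.
rewrite exprMn exprSr natrM natrX mulrC -mulrA ler_wpM2l ?exprn_ge0 //.
rewrite ler_pdivrMr ?exprn_gt0 // in HL; apply: le_trans HL _.
by rewrite ler_pM2r ?exprn_gt0 // ler_nat.
Qed.

(** Sequences of exponential growth rate less than [mu]. *)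
Definition slow mu (f : nat -> nat) := exists nu C : R,
  [/\ 1 <= nu, nu < mu, 0 <= C & forall k, (f k)%:R <= C * nu ^+ k].

Lemma slow_submultiplicative mu (f : nat -> nat) q : (forall n, (0 < f n)%N) ->
  (forall m n, (f (m + n) <= f m * f n)%N) -> {homo f : m n / (m <= n)%N} ->
  1 < mu -> (f q)%:R < mu ^+ q -> slow mu f.
Proof.
move=> f0 fM fm mu1 fq.
have q0 : (0 < q)%N.
  by case: q fq => // ; rewrite expr0 ltNge => /negP[]; rewrite ler1n.
have [nu nu1 Enu] : exists2 nu : R, 1 <= nu & nu ^+ q = (f q)%:R.
  by apply: root_exists => //; rewrite ler1n.
exists nu, (f q)%:R; split=> // [|k].
  rewrite -Enu in fq; rewrite ltNge; apply/negP => munu.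
  by move: fq; rewrite ltNge lerXn2r ?nnegrE //; lra.
rewrite (divn_eq k q); elim: (k %/ q)%N => [|i IHi].
  rewrite mul0n add0n; apply: (@le_trans _ _ (f q)%:R).
    by rewrite ler_nat fm // ltnW // ltn_mod.
  by rewrite ler_peMr // exprn_ege1.
rewrite mulSn -addnA exprD Enu; apply: (@le_trans _ _ ((f q)%:R * (f (i * q + k %% q)%N)%:R)).
  by rewrite -natrM ler_nat.
by rewrite mulrCA ler_wpM2l.
Qed.

Lemma slow_convolution mu (f g s h : nat -> nat) : slow mu f -> slow mu g ->
  (forall k, (s k <= f k)%N) ->
  (forall n, h n = (\sum_(k < n.+1) s k * g (n - k))%N) -> slow mu h.
Proof.
move=> [nu1 [C1 [nu1_1 nu1mu C1_0 H1]]] [nu2 [C2 [nu2_1 nu2mu C2_0 H2]]] sf hE.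
pose nu := Num.max nu1 nu2; have nu_1 : 1 <= nu by rewrite le_max nu1_1.
have numu : nu < mu by rewrite gt_max nu1mu.
have nu0 : 0 < nu by exact: lt_le_trans nu_1.
pose nu' := (nu + mu) / 2; have nunu' : nu < nu' by rewrite /nu'; lra.
have nu'mu : nu' < mu by rewrite /nu'; lra.
pose d := nu' / nu - 1; have d0 : 0 < d by rewrite subr_gt0 ltr_pdivlMr // mul1r.
exists nu', (C1 * C2 * (1 + d^-1)); split=> //; first lra.
  by rewrite !mulr_ge0 // addr_ge0 // invr_ge0 ltW.
move=> n; have step : (h n)%:R <= C1 * C2 * nu ^+ n * n.+1%:R.
  rewrite hE natr_sum; apply: (@le_trans _ _ (\sum_(k < n.+1) C1 * C2 * nu ^+ n)).
    apply: ler_sum => k _; have kn : (k <= n)%N by rewrite -ltnS.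
    have -> : nu ^+ n = nu ^+ k * nu ^+ (n - k) by rewrite -exprD subnKC.
    rewrite natrM mulrACA; apply: ler_pM => //.
      apply: le_trans (_ : (f k)%:R <= _); first by rewrite ler_nat.
      apply: le_trans (H1 k) _; rewrite ler_wpM2l // lerXn2r ?nnegrE ?le_max ?lexx //; lra.
    apply: le_trans (H2 _) _; rewrite ler_wpM2l // lerXn2r ?nnegrE ?le_max ?lexx ?orbT //; lra.
  by rewrite sumr_const card_ord mulr_natr.
apply: le_trans step _; rewrite -!mulrA; do 2! (rewrite ler_wpM2l //).
have -> : nu' = nu * (1 + d) by rewrite /d addrC subrK mulrC divfK // gt_eqF.
rewrite exprMn [X in _ <= X]mulrCA ler_wpM2l ?exprn_ge0 ?(ltW nu0) //.
apply: le_trans (ler_wpM2l _ (bernoulli n (ltW d0))); last first.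
  by rewrite addr_ge0 // invr_ge0 ltW.
have E : d^-1 * (n%:R * d) = n%:R by rewrite mulrCA mulVf ?gt_eqF // mulr1.
have : 0 <= n%:R * d by rewrite mulr_ge0 // ltW.
have : 0 < d^-1 by rewrite invr_gt0.
rewrite -natr1; set p := n%:R * d in E *; set i := d^-1 in E *; move=> i0 p0.
have -> : (1 + i) * (1 + p) = 1 + p + i + i * p by ring.
by rewrite E; lra.
Qed.

Lemma record_time (f : nat -> R) : (forall x, exists k, x < f k) ->
  forall n, exists2 k, (n < k)%N & forall i, (i <= k)%N -> f i <= f k.
Proof.
move=> funb n; pose M := \sum_(i < n.+1) `|f i|.
have [k fk minf] := ex_minnP (funb M).
have leM i : (i <= n)%N -> f i <= M.
  move=> ni; apply: le_trans (ler_norm _) _.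
  by rewrite /M (bigD1 (Ordinal (ni : (i < n.+1)%N))) //= lerDl sumr_ge0.
exists k => [|i].
  by rewrite ltnNge; apply/negP => /leM; rewrite leNgt fk.
rewrite leq_eqVlt => /predU1P[->//|ik]; apply: le_trans (ltW fk).
by rewrite leNgt; apply/negP => /minf; rewrite leqNgt ik.
Qed.

Lemma series_unbounded (t : nat -> R) c : 0 < c -> (forall k, 0 <= t k) ->
  (forall n, exists2 k, (n < k)%N & c <= t k) ->
  forall x, exists L, forall n, (L <= n)%N -> x <= \sum_(k < n.+1) t k.
Proof.
move=> c0 t0 tc x.
have big (j : nat) : exists L, forall n, (L <= n)%N -> j%:R * c <= \sum_(k < n.+1) t k.
  elim: j => [|j [L HL]]; first by exists 0%N => n _; rewrite mul0r sumr_ge0.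
  have [k Lk ck] := tc L; exists k => n kn.
  have -> : \sum_(i < n.+1) t i = \sum_(0 <= i < n.+1) t i by rewrite big_mkord.
  rewrite (@big_cat_nat _ _ _ k) //=; last exact: leqW.
  rewrite (@big_ltn _ _ _ k) //= addrA -natr1 mulrDl mul1r.
  have := HL k.-1; rewrite -(big_mkord xpredT t) (ltn_predK Lk) => HLk.
  apply: ler_wpDr; first by rewrite sumr_ge0.
  by apply: lerD => //; apply: HLk; rewrite -ltnS (ltn_predK Lk).
have [L HL] := big (Num.truncn `|x / c|).+1; exists L => n /HL; apply: le_trans.
rewrite -ler_pdivrMr //; apply: le_trans (ler_norm _) _.
by rewrite ltW // truncnS_gt.
Qed.

Lemma geometric_bound r n : 0 <= r -> r < 1 -> \sum_(k < n) r ^+ k <= (1 - r)^-1.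
Proof.
move=> r0 r1; have r1' : 0 < 1 - r by rewrite subr_gt0.
rewrite -[(1 - r)^-1]mul1r ler_pdivlMr // mulrC -{1}(opprB r 1) mulNr -subrX1 opprB.
by rewrite lerBlDr lerDl exprn_ge0.
Qed.

(** The growth functions [A] and [B] of two groups, of which one has exponential growth,
    are compared with the growth functions [A'] and [B'] of their products with a
    third group of smaller growth rate. A bound from below for
    both [A' n] and [B' n] by a fixed proportion of the growth [N n] of the product of
    all three bounds the partial sums of [b k / A' k + a k / B' k], by
    submultiplicativity. But these diverge: if [k] is a record time of
    [W k / nu ^+ k], where [W = A + B], then the values of [W] before [k] are so small
    that both [A' k] and [B' k] are bounded by a multiple of [W k], and that the
    increment [a k + b k] of [W] is at least a proportion of [W k]. *)
Lemma growth_balance (A B a b A' B' s N : nat -> nat) mu nu C :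
  1 <= nu -> nu < mu -> 0 <= C ->
  (forall k, A k.+1 = (A k + a k.+1)%N) -> (forall k, B k.+1 = (B k + b k.+1)%N) ->
  (forall k, mu ^+ k <= (A k + B k)%:R) -> (forall k, (s k)%:R <= C * nu ^+ k) ->
  (forall n, A' n = (\sum_(k < n.+1) s k * A (n - k))%N) ->
  (forall n, B' n = (\sum_(k < n.+1) s k * B (n - k))%N) ->
  (forall n, (0 < A' n)%N) -> (forall n, (0 < B' n)%N) ->
  (forall m n, (A' (m + n) <= A' m * A' n)%N) ->
  (forall m n, (B' (m + n) <= B' m * B' n)%N) ->
  (forall n, (\sum_(k < n.+1) b k * A' (n - k) <= N n)%N) ->
  (forall n, (\sum_(k < n.+1) a k * B' (n - k) <= N n)%N) ->
  forall K : nat, exists L, forall n, (L <= n)%N -> (K * minn (A' n) (B' n) <= N n)%N.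
Proof.
move=> nu1 numu C0 hA hB hW hs hA' hB' A'0 B'0 A'M B'M NA NB K.
pose t k : R := (b k)%:R / (A' k)%:R + (a k)%:R / (B' k)%:R.
have t0 k : 0 <= t k by rewrite addr_ge0 // divr_ge0.
(* Half-way rates leave room between [nu] and [mu]. *)
pose r := (nu + mu) / 2; have nur : nu < r by rewrite /r; lra.
have rmu : r < mu by rewrite /r; lra.
have r0 : 0 < r by lra.
have r1 : 1 < r by lra.
pose W k : R := (A k + B k)%:R.
have W0 k : 0 <= W k by [].
pose D := C / (1 - nu / r) + 1.
have q1 : nu / r < 1 by rewrite ltr_pdivrMr // mul1r.
have q0 : 0 <= nu / r by rewrite divr_ge0 //; lra.
have D0 : 0 < D by rewrite ltr_pwDr // divr_ge0 // subr_ge0 ltW.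
have mr : 1 < mu / r by rewrite ltr_pdivlMr // mul1r.
have rec n : exists2 k, (n < k)%N & forall i, (i <= k)%N -> W i / r ^+ i <= W k / r ^+ k.
  apply: (record_time (f := fun k => W k / r ^+ k)) => x.
  have [m Hm] := expr_unbounded (x + 1) mr.
  exists m; apply: (@lt_le_trans _ _ (x + 1)); first by rewrite ltrDl.
  apply: le_trans (Hm m (leqnn m)) _; rewrite expr_div_n /=.
  by rewrite ler_pM2r; [exact: hW|rewrite invr_gt0 exprn_gt0].
have Wpos k : 0 < W k by apply: lt_le_trans (hW k); rewrite exprn_gt0 //; lra.
have prodbound k (Z Z' : nat -> nat) : (forall i, (i <= k)%N -> W i / r ^+ i <= W k / r ^+ k) ->
    (forall i, (Z i)%:R <= W i) ->
    Z' k = (\sum_(j < k.+1) s j * Z (k - j))%N -> (Z' k)%:R <= D * W k.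
  move=> reck ZW ->; rewrite natr_sum.
  apply: (@le_trans _ _ (\sum_(j < k.+1) C * W k * (nu / r) ^+ j)).
    apply: ler_sum => j _; have jk : (j <= k)%N by rewrite -ltnS.
    rewrite natrM expr_div_n mulrACA; apply: ler_pM => //.
    apply: le_trans (ZW _) _; have := reck _ (leq_subr j k).
    rewrite ler_pdivrMr ?exprn_gt0 // => /le_trans; apply.
    have -> : r ^+ k = r ^+ j * r ^+ (k - j) by rewrite -exprD subnKC.
    rewrite -mulrA ler_wpM2l // invfM -mulrA.
    by rewrite mulVf ?mulr1 // expf_neq0 // gt_eqF.
  rewrite -big_distrr /= mulrAC ler_wpM2r //.
  apply: (@le_trans _ _ (C * (1 - nu / r)^-1)); last by rewrite /D lerDl.
  by rewrite ler_wpM2l // geometric_bound.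
have tc n : exists2 k, (n < k)%N & (1 - r^-1) / D <= t k.
  have [k nk reck] := rec n; exists k => //.
  have bA : (A' k)%:R <= D * W k.
    by apply: prodbound (hA' k) => // i; rewrite /W ler_nat leq_addr.
  have bB : (B' k)%:R <= D * W k.
    by apply: prodbound (hB' k) => // i; rewrite /W ler_nat leq_addl.
  have inc : W k - W k.-1 = (b k)%:R + (a k)%:R.
    rewrite -(ltn_predK nk) /W hA hB /= !natrD; ring.
  have Wk : W k.-1 <= W k / r.
    have := reck _ (leq_pred k); rewrite ler_pdivrMr ?exprn_gt0 // => /le_trans; apply.
    have -> : r ^+ k = r * r ^+ k.-1 by rewrite -exprS (ltn_predK nk).
    by rewrite invfM !mulrA divfK // expf_neq0 // gt_eqF.
  apply: (@le_trans _ _ (((b k)%:R + (a k)%:R) / (D * W k))).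
    rewrite ler_pdivlMr ?mulr_gt0 // mulrA divfK ?gt_eqF // -inc.
    by rewrite mulrBl mul1r lerD2l lerN2 mulrC.
  have dp : D * W k \is Num.pos by rewrite posrE mulr_gt0.
  have pp (z : nat) : (0 < z)%N -> (z%:R : R) \is Num.pos by move=> z0; rewrite posrE ltr0n.
  by rewrite mulrDl; apply: lerD; rewrite ler_wpM2l // lef_pV2 // pp.
have c0 : 0 < (1 - r^-1) / D by rewrite divr_gt0 // subr_gt0 invf_lt1.
have [L HL] := series_unbounded c0 t0 tc (2 * K%:R).
exists L => n /HL Kt; rewrite -(ler_nat R) natrM.
set m := minn (A' n) (B' n).
have half (Z' z : nat -> nat) : (m <= Z' n)%N -> (forall i, (0 < Z' i)%N) ->
    (forall i j, (Z' (i + j) <= Z' i * Z' j)%N) ->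
    (\sum_(k < n.+1) z k * Z' (n - k) <= N n)%N ->
    \sum_(k < n.+1) (z k)%:R / (Z' k)%:R * m%:R <= (N n)%:R :> R.
  move=> mZ Z0 ZM; rewrite -(ler_nat R) => hN; apply: le_trans _ hN.
  rewrite natr_sum; apply: ler_sum => k _; have kn : (k <= n)%N by rewrite -ltnS.
  rewrite natrM -mulrA ler_wpM2l // mulrC ler_pdivrMr ?ltr0n // mulrC -natrM ler_nat.
  by apply: leq_trans mZ _; rewrite -{1}(subnKC kn).
have h1 := half A' b (geq_minl _ _) A'0 A'M (NA n).
have h2 := half B' a (geq_minr _ _) B'0 B'M (NB n).
have : (\sum_(k < n.+1) t k) * m%:R <= (N n)%:R + (N n)%:R.
  rewrite big_distrl /=; apply: le_trans (lerD h1 h2); rewrite -big_split /=.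
  by apply: ler_sum => k _; rewrite /t mulrDl.
have : 2 * K%:R * m%:R <= (\sum_(k < n.+1) t k) * m%:R by rewrite ler_wpM2r.
lra.
Qed.

End Sequences.

(** * Reduced words and shuffles *)

Section Words.
Variables (V : finType) (e : rel V) (H : V -> groupType).
Hypotheses (e_sym : symmetric e) (e_irr : irreflexive e).
Implicit Types (v u : V) (a b : syllable H) (s t w : seq (syllable H)).

Definition at_vertex v a : H v := untag 1 (fun x : H v => x) a.

Lemma at_vertexE a : at_vertex (tag a) a = tagged a.
Proof.
rewrite /at_vertex (untagE _ _ (erefl (tag a))).
by case: a.
Qed.

Lemma at_vertex_syl v (h : H v) : at_vertex v (syl h) = h.
Proof. exact: (at_vertexE (syl h)). Qed.

Lemma syl_at_vertex v a : tag a = v -> syl (at_vertex v a) = a.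
Proof. by move=> <-; rewrite at_vertexE; case: a. Qed.

(** A syllable at [v] can be shuffled to the front of a word when all syllables
    before it are at vertices adjacent to [v]. The front at [v] is the value of this
    syllable, and 1 stands for its absence. *)
Fixpoint wfront v s : H v :=
  if s is a :: s' then
    if tag a == v then at_vertex v a else if e v (tag a) then wfront v s' else 1
  else 1.

Fixpoint wtail v s : seq (syllable H) :=
  if s is a :: s' then
    if tag a == v then s' else if e v (tag a) then a :: wtail v s' else s
  else [::].

Fixpoint reduced s : bool :=
  if s is a :: s' then
    [&& tagged a != 1, wfront (tag a) s' == 1 & reduced s']
  else true.

(** Left multiplication by a syllable, on words that stand for their shuffle classes.
    As in van der Waerden's treatment of free products, this action yields normal
    forms without a confluence argument. *)
Definition put a w : seq (syllable H) :=
  let h := tagged a * wfront (tag a) w in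
  if h == 1 then wtail (tag a) w else syl h :: wtail (tag a) w.

Definition puts s w := foldr put w s.

Inductive shuffle : seq (syllable H) -> seq (syllable H) -> Prop :=
| shuffle_refl s : shuffle s s
| shuffle_trans s t w : shuffle s t -> shuffle t w -> shuffle s w
| shuffle_swap s a b t : e (tag a) (tag b) ->
    shuffle (s ++ a :: b :: t) (s ++ b :: a :: t).

Lemma e_neq u v : e u v -> u != v.
Proof. by apply: contraTneq => ->; rewrite e_irr. Qed.

Lemma shuffle_sym s t : shuffle s t -> shuffle t s.
Proof.
elim=> {s t} [s|s t w _ st _ tw|s a b t ab]; first exact: shuffle_refl.
  exact: shuffle_trans tw st.
by apply: shuffle_swap; rewrite e_sym.
Qed.

Lemma shuffle_cons a s t : shuffle s t -> shuffle (a :: s) (a :: t).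
Proof.
elim=> {s t} [s|s t w _ st _ tw|s b c t bc]; first exact: shuffle_refl.
  exact: shuffle_trans st tw.
by rewrite -!cat_cons; apply: shuffle_swap.
Qed.

Lemma shuffle_perm s t : shuffle s t -> perm_eq s t.
Proof.
elim=> {s t} [s|s t w _ st _ tw|s b c t bc]; first by [].
  exact: perm_trans st tw.
by rewrite perm_cat2l -cat1s -(cat1s c) -(cat1s c (b :: t)) -(cat1s b t) perm_catCA.
Qed.

Lemma wfront_tail1 v s : ~~ has (fun a => tag a == v) s -> wfront v s = 1.
Proof.
elim: s => [|a s IHs] //=; rewrite negb_or => /andP[/negbTE -> /IHs ->].
by case: ifP.
Qed.

Lemma shuffle_front v s t : shuffle s t -> wfront v s = wfront v t.
Proof.
elim=> {s t} [s //|s t w _ -> _ -> //|s a b t ab].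
elim: s => [|c s IHs] /=; last by rewrite IHs.
case: (eqVneq (tag a) v) => [av|av]; case: (eqVneq (tag b) v) => [bv|bv].
- by rewrite av bv e_irr in ab.
- by rewrite -av ab.
- by rewrite -bv e_sym ab.
- by case: (e v (tag a)); case: (e v (tag b)).
Qed.

Lemma shuffle_tail v s t : shuffle s t -> shuffle (wtail v s) (wtail v t).
Proof.
elim=> {s t} [s|s t w _ st _ tw|s a b t ab]; first exact: shuffle_refl.
  exact: shuffle_trans st tw.
elim: s => [|c s IHs] /=; last first.
  case: ifP => _; first exact: shuffle_swap.
  case: ifP => _; first exact: shuffle_cons.
  exact: (shuffle_swap (c :: s)).
case: (eqVneq (tag a) v) => [av|av]; case: (eqVneq (tag b) v) => [bv|bv].
- by rewrite av bv e_irr in ab.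
- by rewrite -av ab; exact: shuffle_refl.
- by rewrite -bv e_sym ab; exact: shuffle_refl.
- by case: (e v (tag a)); case: (e v (tag b)) => /=;
     [exact: (shuffle_swap [::])..].
Qed.

Lemma shuffle_put a s t : shuffle s t -> shuffle (put a s) (put a t).
Proof.
move=> st; rewrite /put (shuffle_front _ st); case: ifP => _.
  exact: shuffle_tail.
exact/shuffle_cons/shuffle_tail.
Qed.

Lemma shuffle_puts w s t : shuffle s t -> shuffle (puts w s) (puts w t).
Proof. by elim: w => //= a w IHw /IHw; exact: shuffle_put. Qed.

Lemma front_tail u v s : e u v -> wfront v (wtail u s) = wfront v s.
Proof.
move=> uv; elim: s => [|a s IHs] //=.
case: (eqVneq (tag a) u) => [au|au].
  by rewrite au (negbTE (e_neq uv)) e_sym uv.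
by case: ifP => _ /=; rewrite ?IHs.
Qed.

Lemma tail_tail u v s : e u v -> wtail v (wtail u s) = wtail u (wtail v s).
Proof.
move=> uv; elim: s => [|a s IHs] //=.
case: (eqVneq (tag a) u) => [au|au]; case: (eqVneq (tag a) v) => [av|av].
- by rewrite -au av e_irr in uv.
- by rewrite au e_sym uv /= au eqxx.
- by rewrite av uv /= av eqxx.
- case eua: (e u (tag a)); case eva: (e v (tag a)) => /=;
    rewrite ?(negbTE au) ?(negbTE av) ?eua ?eva ?IHs //.
Qed.

Lemma reduced_tail v s : reduced s -> reduced (wtail v s).
Proof.
elim: s => [|a s IHs] //= /and3P[a1 fa rs]; case: ifP => // _.
case: ifP => eva /=; last by rewrite a1 fa.
by rewrite a1 front_tail // fa IHs.
Qed.

Lemma front_tail_same v s : reduced s -> wfront v (wtail v s) = 1.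
Proof.
elim: s => [|a s IHs] //= /and3P[a1 /eqP fa rs].
case: (eqVneq (tag a) v) => [<- //|av].
by case eva: (e v (tag a)); rewrite /= (negbTE av) eva // IHs.
Qed.

Lemma reduced_put a s : reduced s -> reduced (put a s).
Proof.
move=> rs; rewrite /put; case: ifP => a1; first exact: reduced_tail.
by rewrite /= a1 front_tail_same // eqxx reduced_tail.
Qed.

Lemma reduced_puts w s : reduced s -> reduced (puts w s).
Proof. by elim: w => //= a w IHw /IHw; exact: reduced_put. Qed.

Lemma tail_id v s : reduced s -> wfront v s = 1 -> wtail v s = s.
Proof.
elim: s => [|a s IHs] //= /and3P[a1 fa rs].
case: (eqVneq (tag a) v) => [av va1|av].
  by move: a1; rewrite -at_vertexE av va1 eqxx.
by case: ifP => // _ /(IHs rs) ->.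
Qed.

Lemma puts_reduced s : reduced s -> puts s [::] = s.
Proof.
elim: s => [|a s IHs] //= /and3P[a1 /eqP fa rs]; rewrite IHs // /put fa mulg1.
by rewrite (negbTE a1) tail_id //; case: a {a1 fa}.
Qed.

Lemma put1 v w : reduced w -> shuffle (put (syl (1 : H v)) w) w.
Proof.
move=> rw; rewrite /put /= mul1g; case: ifP => [/eqP f1|].
  by rewrite tail_id //; exact: shuffle_refl.
elim: w rw => [|a w IHw] /=; first by rewrite eqxx.
move=> /and3P[a1 fa rw].
case: (eqVneq (tag a) v) => [av _|av].
  by rewrite syl_at_vertex //; exact: shuffle_refl.
case eva: (e v (tag a)); last by rewrite eqxx.
move=> /(IHw rw) sh; apply: shuffle_trans (shuffle_cons a sh).
by apply: (shuffle_swap [::]).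
Qed.

Lemma putM v (g h : H v) w : reduced w ->
  put (syl g) (put (syl h) w) = put (syl (g * h)) w.
Proof.
move=> rw; rewrite [put (syl h) w]/put /=; case: ifP => [/eqP h1|h1].
  rewrite /put /= front_tail_same // mulg1 -mulgA h1 mulg1.
  by rewrite [X in syl g :: X]tail_id ?front_tail_same ?reduced_tail //;
     rewrite [X in if _ then X else _]tail_id ?front_tail_same ?reduced_tail.
by rewrite /put /= eqxx at_vertex_syl -mulgA.
Qed.

Lemma put_comm a b w : e (tag a) (tag b) ->
  shuffle (put a (put b w)) (put b (put a w)).
Proof.
move=> ab; have ba : e (tag b) (tag a) by rewrite e_sym.
have /negbTE nab := e_neq ab; have /negbTE nba := e_neq ba.
have F c d : e (tag c) (tag d) -> wfront (tag c) (put d w) = wfront (tag c) w.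
  move=> cd; have dc : e (tag d) (tag c) by rewrite e_sym.
  rewrite /put; case: ifP => _; rewrite ?front_tail //=.
  by rewrite (negbTE (e_neq dc)) cd front_tail.
rewrite {1}/put F // {1 3}/put F //.
rewrite /put; case: ifP => ha; case: ifP => hb /=.
- by rewrite tail_tail //; exact: shuffle_refl.
- by rewrite nba ab tail_tail //; exact: shuffle_refl.
- by rewrite nab ba tail_tail //; exact: shuffle_refl.
- by rewrite nab nba ab ba /= tail_tail //; exact: (shuffle_swap [::]).
Qed.

(** * The word problem of a graph product *)

Local Notation G := (graph_product e H).
Implicit Types (g h x y z : graph_product e H) (T S : {set V}).

Definition gpw s : G := ncl_pi (@graph_relators V e H) (fp_pi s).

Lemma gpw_cat s t : gpw (s ++ t) = gpw s * gpw t.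
Proof. by rewrite /gpw -ncl_piM; congr ncl_pi; rewrite -fp_mulE. Qed.

Lemma gpw_nil : gpw [::] = 1.
Proof. by []. Qed.

Lemma gpw_syl v (h : H v) : gpw [:: syl h] = gp_in e h.
Proof. by []. Qed.

Lemma gpw_cons a s : gpw (a :: s) = gpw [:: a] * gpw s.
Proof. exact: (gpw_cat [:: a]). Qed.

Lemma gpw_surj g : exists s, gpw s = g.
Proof.
elim/nclq_ind: g => x; elim/fp_ind: x => s; by exists s.
Qed.

Lemma gpw_inv s : gpw (word_inv s) = (gpw s)^-1.
Proof.
apply: (mulIg (gpw s)); rewrite mulVg -gpw_cat.
by congr ncl_pi; apply/fp_piP/fp_eqv_invl.
Qed.

Lemma gpw_comm a b : e (tag a) (tag b) -> commute (gpw [:: a]) (gpw [:: b]).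
Proof.
case: a b => [v g] [w h] /= vw; apply/commgP/eqP.
rewrite -[gpw [:: existT _ v g]]/(ncl_pi _ (fp_in g)).
rewrite -[gpw [:: existT _ w h]]/(ncl_pi _ (fp_in h)) -gmulfR.
rewrite -[RHS]/(ncl_pi _ 1); apply/ncl_piP => N [N1 NM NV NJ] SN.
by rewrite mulg1; apply/NV/SN; exists v; exists w; exists g; exists h.
Qed.

Lemma gpw_merge v (h k : H v) s :
  gpw (syl h :: syl k :: s) = gpw (syl (h * k) :: s).
Proof. by congr ncl_pi; apply/fp_piP/(fp_merge [::]). Qed.

Lemma gpw_one v s : gpw (syl (1 : H v) :: s) = gpw s.
Proof. by congr ncl_pi; apply/fp_piP/(fp_unit [::]). Qed.

Lemma gpw_front v s : gpw (syl (wfront v s) :: wtail v s) = gpw s.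
Proof.
elim: s => [|a s IHs] /=; first exact: gpw_one.
case: (eqVneq (tag a) v) => [av|av]; first by rewrite syl_at_vertex.
case eva: (e v (tag a)); last exact: gpw_one.
rewrite gpw_cons [gpw (a :: wtail v s)]gpw_cons mulgA.
by rewrite (@gpw_comm (syl (wfront v s)) a) // -mulgA -(gpw_cons (syl (wfront v s))) IHs -gpw_cons.
Qed.

Lemma gpw_put a w : gpw (put a w) = gpw (a :: w).
Proof.
rewrite gpw_cons -(gpw_front (tag a) w) -gpw_cons; case: a => v k /=.
rewrite gpw_merge /put /=; case: ifP => // /eqP ->; exact/esym/gpw_one.
Qed.

Lemma gpw_puts s w : gpw (puts s w) = gpw s * gpw w.
Proof.
elim: s => [|a s IHs] /=; first by rewrite gpw_nil mul1g.
by rewrite gpw_put gpw_cons IHs mulgA -gpw_cons.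
Qed.

Lemma puts_cat s t w : puts (s ++ t) w = puts s (puts t w).
Proof. exact: foldr_cat. Qed.

Lemma fp_eqv_puts s t : fp_eqv s t ->
  forall w, reduced w -> shuffle (puts s w) (puts t w).
Proof.
elim=> {s t} [s w _|s t _ IH w rw|s t u _ IHs _ IHt w rw|s t v w rw|s t v g h w rw].
- exact: shuffle_refl.
- exact/shuffle_sym/IH.
- exact: shuffle_trans (IHs _ rw) (IHt _ rw).
- by rewrite !puts_cat; apply/shuffle_puts/put1/reduced_puts.
- rewrite !puts_cat; apply: shuffle_puts; rewrite /= putM ?reduced_puts //.
  exact: shuffle_refl.
Qed.

(** The elements of the free product that act on reduced words by shuffles form a
    normal subgroup, and it contains the relators; so the action passes to the graph
    product. *)
Lemma gpw_eq_puts s t w : gpw s = gpw t -> reduced w ->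
  shuffle (puts s w) (puts t w).
Proof.
pose N : set (free_product H) := [set x | forall s, fp_pi s = x ->
  forall w, reduced w -> shuffle (puts s w) w].
have Vfp s1 : fp_pi (word_inv s1) = (fp_pi s1)^-1.
  by rewrite -[LHS]fp_invE.
have Mfp s1 s2 : fp_pi s1 * fp_pi s2 = fp_pi (s1 ++ s2) by rewrite -fp_mulE.
have M3 s1 s2 s3 :
    fp_pi s1 * (fp_pi s2 * fp_pi s3) = fp_pi (s1 ++ s2 ++ s3).
  by rewrite (Mfp s2 s3) Mfp.
have toN s1 : (forall w, reduced w -> shuffle (puts s1 w) w) -> N (fp_pi s1).
  move=> hx y /fp_piP yx z rz.
  exact: shuffle_trans (fp_eqv_puts yx rz) (hx _ rz).
have nN : normal_subgroup N.
  split.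
  - by apply: (@toN [::]) => z _; exact: shuffle_refl.
  - elim/fp_ind=> x; elim/fp_ind=> y Nx Ny; rewrite Mfp.
    apply: toN => z rz; rewrite puts_cat.
    by apply: shuffle_trans (Ny y _ _ rz) => //; apply: Nx (reduced_puts _ rz).
  - elim/fp_ind=> x Nx; rewrite -Vfp; apply: toN => z rz.
    apply: shuffle_trans (shuffle_puts _ (shuffle_sym (Nx x erefl _ rz))) _.
    by rewrite -puts_cat; exact: (fp_eqv_puts (fp_eqv_invl x) rz).
  - elim/fp_ind=> x; elim/fp_ind=> y Nx.
    rewrite /conjg -Vfp M3; apply: toN => z rz.
    rewrite !puts_cat.
    apply: shuffle_trans (shuffle_puts _ (Nx x erefl _ (reduced_puts y rz))) _.
    by rewrite -puts_cat; exact: (fp_eqv_puts (fp_eqv_invl y) rz).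
have SN : @graph_relators V e H `<=` N.
  move=> _ [u [v [h [k [uv ->]]]]]; rewrite commgEl /conjg /fp_in -!Vfp.
  rewrite (M3 _ [:: syl h] [:: syl k]) Mfp; apply: toN => z rz /=.
  rewrite /word_inv /= /syl_inv /=.
  apply: shuffle_trans.
    by apply: shuffle_put; apply: put_comm; rewrite /= e_sym.
  apply: shuffle_trans.
    apply: shuffle_put; apply: shuffle_put; rewrite putM // mulVg.
    exact: put1.
  by rewrite putM // mulVg; apply: put1.
move=> /ncl_piP nc rw; have := nc N nN SN; rewrite -Vfp.
rewrite Mfp => /(_ _ erefl _ rw) sh.
have := shuffle_puts s (shuffle_sym sh); rewrite puts_cat -puts_cat => sh1.
apply: shuffle_trans sh1 _; rewrite -[X in shuffle _ X]/(puts [::] _).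
apply: fp_eqv_puts (reduced_puts _ rw).
by rewrite -{1}[s]word_invK; exact: fp_eqv_invl.
Qed.

(** A reduced word is recovered up to shuffle from its action on the empty word. *)
Lemma reduced_unique s t : reduced s -> reduced t -> gpw s = gpw t ->
  shuffle s t.
Proof.
move=> rs rt /gpw_eq_puts /(_ (erefl : reduced [::])).
by rewrite !puts_reduced.
Qed.

Lemma reduced_wordP g : exists s, reduced s && (gpw s == g).
Proof.
have [s <-] := gpw_surj g; exists (puts s [::]).
by rewrite reduced_puts // gpw_puts mulg1 /=.
Qed.

Definition nf g : seq (syllable H) := sval (cid (reduced_wordP g)).

Lemma reduced_nf g : reduced (nf g).
Proof. by rewrite /nf; case: cid => s /= /andP[]. Qed.

Lemma nfK : cancel nf gpw.
Proof. by move=> g; rewrite /nf; case: cid => s /= /andP[_ /eqP]. Qed.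

Lemma nf_puts s w : reduced w -> shuffle (nf (gpw s * gpw w)) (puts s w).
Proof.
move=> rw; apply: reduced_unique (reduced_nf _) (reduced_puts _ rw) _.
by rewrite nfK gpw_puts.
Qed.

Lemma nf_gpw s : reduced s -> shuffle (nf (gpw s)) s.
Proof.
by move=> rs; have := nf_puts [::] rs; rewrite gpw_nil mul1g.
Qed.

Lemma nf_gpw_puts s : shuffle (nf (gpw s)) (puts s [::]).
Proof. by have := nf_puts s (erefl : reduced [::]); rewrite gpw_nil mulg1. Qed.

(** * Fronts, supports and costs of elements *)

Definition front v g : H v := wfront v (nf g).
Definition supp g : {set V} := [set v | v \in map (@tag _ _) (nf g)].
Definition link v : {set V} := [set u | e v u].
Definition cost (c : syllable H -> nat) g : nat := (\sum_(a <- nf g) c a)%N.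
Definition sylen g : nat := size (nf g).

(** Costs of syllables for which merging does not raise the total cost of a word. The
    syllable count, the number of syllables at a vertex and the word length are all of
    this kind. *)
Definition seminorm (c : syllable H -> nat) : Prop :=
  [/\ forall v, c (syl (1 : H v)) = 0%N,
      forall v (h k : H v), (c (syl (h * k)%g) <= c (syl h) + c (syl k))%N
    & forall v (h : H v), c (syl h^-1) = c (syl h)].

Lemma front_gpw v s : reduced s -> front v (gpw s) = wfront v s.
Proof. by move=> /nf_gpw; exact: shuffle_front. Qed.

Lemma mem_suppP v g : reflect (exists2 a, a \in nf g & v = tag a) (v \in supp g).
Proof. by rewrite inE; apply: mapP. Qed.

Lemma supp_subP g T :
  reflect (forall a, a \in nf g -> tag a \in T) (supp g \subset T).
Proof.
apply: (iffP fintype.subsetP) => [gT a ag|gT v /mem_suppP[a ag ->]]; last exact: gT.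
by apply: gT; apply/mem_suppP; exists a.
Qed.

Lemma mem_supp_gpw v s : reduced s ->
  (v \in supp (gpw s)) = (v \in map (@tag _ _) s).
Proof. by move=> /nf_gpw/shuffle_perm/(perm_map (@tag _ _))/perm_mem sh; rewrite inE sh. Qed.

Lemma mem_tail v s : {subset wtail v s <= s}.
Proof.
elim: s => //= a s IHs b; case: ifP => _; first by rewrite inE => ->; rewrite orbT.
case: ifP => // _; rewrite !inE => /predU1P[->|/IHs ->]; first by rewrite eqxx.
by rewrite orbT.
Qed.

Lemma all_put (T : {set V}) a w : tag a \in T -> all (fun b => tag b \in T) w ->
  all (fun b => tag b \in T) (put a w).
Proof.
move=> aT /allP wT; rewrite /put; case: ifP => _ /=; rewrite ?aT;
  by apply/allP => b /mem_tail/wT.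
Qed.

Lemma supp_gpw_sub s T : all (fun b => tag b \in T) s -> supp (gpw s) \subset T.
Proof.
move=> sT; apply/supp_subP; apply/allP.
rewrite (perm_all _ (shuffle_perm (nf_gpw_puts s))).
by elim: s sT => //= a s IHs /andP[aT /IHs]; exact: all_put.
Qed.

Lemma supp_all g T : supp g \subset T -> all (fun b => tag b \in T) (nf g).
Proof. by move=> /supp_subP gT; apply/allP. Qed.

Lemma supp1 T : supp 1 \subset T.
Proof. exact: (@supp_gpw_sub [::]). Qed.

Lemma suppM g h T : supp g \subset T -> supp h \subset T -> supp (g * h) \subset T.
Proof.
move=> gT hT; rewrite -[g]nfK -[h]nfK -gpw_cat; apply: supp_gpw_sub.
by rewrite all_cat !supp_all.
Qed.

Lemma word_inv_all (P : pred V) s :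
  all (fun b => P (tag b)) (word_inv s) = all (fun b => P (tag b)) s.
Proof. by rewrite /word_inv all_rev all_map; apply: eq_all. Qed.

Lemma suppV g T : supp g \subset T -> supp g^-1 \subset T.
Proof.
move=> gT; rewrite -[g]nfK -gpw_inv; apply: supp_gpw_sub.
by rewrite (word_inv_all (mem T)) supp_all.
Qed.

Lemma supp_in v (h : H v) T : v \in T -> supp (gp_in e h) \subset T.
Proof. by move=> vT; rewrite -gpw_syl; apply: supp_gpw_sub; rewrite /= vT. Qed.

Lemma supp_eq1 g : supp g \subset finset.set0 -> g = 1.
Proof.
move=> /supp_subP g0; rewrite -[g]nfK; case E: (nf g) => [//|a s].
by have := g0 a; rewrite E inE eqxx finset.in_set0 => /(_ erefl).
Qed.

(** ** Costs *)

Lemma cost_gpw c s : reduced s -> cost c (gpw s) = (\sum_(a <- s) c a)%N.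
Proof. by move=> /nf_gpw/shuffle_perm sh; exact: perm_big. Qed.

Lemma sum_tail_eq c v s : seminorm c ->
  (c (syl (wfront v s)) + \sum_(a <- wtail v s) c a = \sum_(a <- s) c a)%N.
Proof.
case=> c1 _ _; elim: s => [|a s IHs] /=; first by rewrite big_nil c1.
case: eqVneq => [av|_]; first by rewrite syl_at_vertex // big_cons.
by case: ifP => _; rewrite !big_cons ?c1; lia.
Qed.

Lemma sum_put c a w : seminorm c ->
  (\sum_(b <- put a w) c b <= c a + \sum_(b <- w) c b)%N.
Proof.
move=> sc; have [c1 cM _] := sc; rewrite /put -(sum_tail_eq (tag a) w sc).
have := cM _ (tagged a) (wfront (tag a) w).
have -> : c (syl (tagged a)) = c a by case: a.
by case: ifP => _; rewrite ?big_cons; lia.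
Qed.

Lemma cost_gpw_le c s : seminorm c -> (cost c (gpw s) <= \sum_(a <- s) c a)%N.
Proof.
move=> sc; rewrite /cost.
rewrite (perm_big _ (shuffle_perm (nf_gpw_puts s))) /=; elim: s => [|a s IHs] /=.
  by rewrite big_nil.
by apply: leq_trans (sum_put _ _ sc) _; rewrite big_cons leq_add2l.
Qed.

Lemma cost1 c : cost c 1 = 0%N.
Proof. by rewrite (@cost_gpw c [::]) // big_nil. Qed.

Lemma cost_in c v (h : H v) : seminorm c -> cost c (gp_in e h) = c (syl h).
Proof.
case=> c1 _ _; have [->|h1] := eqVneq h 1.
  rewrite c1 -(cost1 c) -gpw_syl; congr cost; exact: gpw_one.
by rewrite -gpw_syl cost_gpw ?big_seq1 //= h1 eqxx.
Qed.

Lemma costM c g h : seminorm c -> (cost c (g * h) <= cost c g + cost c h)%N.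
Proof.
move=> sc; rewrite -{1}[g]nfK -{1}[h]nfK -gpw_cat.
by apply: leq_trans (cost_gpw_le _ sc) _; rewrite big_cat.
Qed.

Lemma costV c g : seminorm c -> cost c g^-1 = cost c g.
Proof.
move=> sc; have [_ _ cV] := sc.
have le h : (cost c h^-1 <= cost c h)%N.
  rewrite -[h in X in (X <= _)%N]nfK -gpw_inv.
  apply: leq_trans (cost_gpw_le _ sc) _; rewrite /cost /word_inv.
  rewrite (perm_big (map (@syl_inv _ _) (nf h))) ?perm_rev // big_map.
  by apply: leq_sum => -[v k] _; rewrite cV.
by apply/eqP; rewrite eqn_leq le -{1}[g]invgK le.
Qed.

Definition nontrivial a : nat := (tagged a != 1).
Definition visits v a : nat := (tag a == v) && (tagged a != 1).

Lemma seminorm_nontrivial : seminorm nontrivial.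
Proof.
split=> [v|v h k|v h]; rewrite /nontrivial /= ?eqxx ?invg_eq1 //.
have [->|_] := eqVneq h 1; first by rewrite mul1g leq_addl.
by case: (_ != 1).
Qed.

Lemma seminorm_visits v : seminorm (visits v).
Proof.
have [c1 cM cV] := seminorm_nontrivial.
split=> [u|u h k|u h]; rewrite /visits /=; case: (u == v) => //=.
- exact: c1.
- exact: cM.
- exact: cV.
Qed.

Lemma reduced_neq1 s a : reduced s -> a \in s -> tagged a != 1.
Proof.
elim: s => //= b s IHs /and3P[b1 _ rs]; rewrite inE => /predU1P[->//|].
exact: IHs.
Qed.

Lemma sum_nontrivial s : reduced s -> (\sum_(a <- s) nontrivial a)%N = size s.
Proof.
move=> rs; rewrite -sum1_size big_seq [RHS]big_seq; apply: eq_bigr => a ain.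
by rewrite /nontrivial (reduced_neq1 rs ain).
Qed.

Lemma sylen_cost g : sylen g = cost nontrivial g.
Proof. by rewrite /cost sum_nontrivial // reduced_nf. Qed.

Lemma sylenM g h : (sylen (g * h) <= sylen g + sylen h)%N.
Proof. by rewrite !sylen_cost; exact: costM seminorm_nontrivial. Qed.

Lemma sylenV g : sylen g^-1 = sylen g.
Proof. by rewrite !sylen_cost; exact: costV seminorm_nontrivial. Qed.

Lemma sylen_gpw s : reduced s -> sylen (gpw s) = size s.
Proof. by move=> rs; rewrite sylen_cost cost_gpw // sum_nontrivial. Qed.

Lemma sylen_gpw_le s : (sylen (gpw s) <= size s)%N.
Proof.
rewrite sylen_cost; apply: leq_trans (cost_gpw_le _ seminorm_nontrivial) _.
by rewrite -sum1_size; apply: leq_sum => a _; rewrite /nontrivial; case: (_ != 1).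
Qed.

Lemma size_tail v s : reduced s -> ((wfront v s != 1%g) + size (wtail v s) = size s)%N.
Proof.
move=> rs; rewrite -(sum_nontrivial rs) -(sum_nontrivial (reduced_tail v rs)).
exact: (sum_tail_eq v s seminorm_nontrivial).
Qed.

(** A word that is not reduced has a syllable that is absorbed by the normal form of
    the rest. This characterisation by lengths shows that inverses and factors of
    reduced words are reduced. *)
Lemma reduced_shortest s : sylen (gpw s) = size s -> reduced s.
Proof.
have Esz t : sylen (gpw t) = size (puts t [::]).
  exact/perm_size/shuffle_perm/nf_gpw_puts.
have rp t : reduced (puts t [::]) by exact: reduced_puts.
elim: s => [|[v h] s IHs] //=; rewrite Esz /= => sz.
have le1 := sylen_gpw_le s; rewrite Esz in le1.
have szt := size_tail v (rp s).
have rs : reduced s.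
  by apply: IHs; rewrite Esz; move: sz; rewrite /put; case: ifP => _ /=; lia.
rewrite rs puts_reduced // in sz szt *; rewrite andbT.
case: (eqVneq (wfront v s) 1) szt sz => [f1|f1] /= szt; rewrite /put /=.
  rewrite f1 mulg1; case: eqVneq => //= a1; lia.
by case: ifP => _ /=; lia.
Qed.

Lemma size_word_inv s : size (word_inv s) = size s.
Proof. by rewrite /word_inv size_rev size_map. Qed.

Lemma reduced_inv s : reduced s -> reduced (word_inv s).
Proof.
move=> rs; apply: reduced_shortest.
by rewrite gpw_inv sylenV sylen_gpw // size_word_inv.
Qed.

Lemma reduced_cat_l s t : reduced (s ++ t) -> reduced s.
Proof.
move=> /sylen_gpw; rewrite gpw_cat size_cat => sz; apply: reduced_shortest.
have := sylenM (gpw s) (gpw t); have := sylen_gpw_le s.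
have := sylen_gpw_le t; lia.
Qed.

Lemma reduced_cat_r s t : reduced (s ++ t) -> reduced t.
Proof. by elim: s => //= a s IHs /and3P[_ _]. Qed.

(** * Products without cancellation *)

Lemma wfront_adj v s : all (fun b => e v (tag b)) s -> wfront v s = 1.
Proof.
elim: s => //= a s IHs /andP[va /IHs]; rewrite va.
by rewrite eq_sym (negbTE (e_neq va)).
Qed.

Lemma wfront_cat v s t : wfront v (s ++ t) =
  if all (fun b => e v (tag b)) s then wfront v t else wfront v s.
Proof.
elim: s => //= a s ->; case: eqVneq => [->|_]; first by rewrite e_irr.
by case: (e v (tag a)).
Qed.

Lemma word_inv_cons a s : word_inv (a :: s) = rcons (word_inv s) (syl_inv a).
Proof. by rewrite /word_inv /= rev_cons. Qed.

Lemma reduced_cat s t : reduced s -> reduced t ->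
  (forall v, wfront v t = 1 \/ wfront v (word_inv s) = 1) -> reduced (s ++ t).
Proof.
move=> + rt; elim: s => //= -[u h] s IHs /= /and3P[h1 /eqP fs rs] nc.
rewrite h1 /= IHs // ?andbT => [|v].
  rewrite wfront_cat; case: ifP => sadj; last by rewrite fs.
  have [->//|] := nc u; rewrite word_inv_cons -cats1 wfront_cat.
  rewrite (word_inv_all (e u)) sadj /= eqxx -[syl_inv _]/(syl h^-1) at_vertex_syl.
  by move=> /eqP; rewrite invg_eq1 (negbTE h1).
have [->|] := nc v; first by left.
rewrite word_inv_cons -cats1 wfront_cat; case: ifP => sadj fv; right; last exact: fv.
exact: wfront_adj.
Qed.

(** A syllable of [g] and a syllable of [h] can only merge at a vertex where the first
    can be shuffled to the end of [g] and the second to the front of [h]. *)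
Definition no_cancel g h := forall v, front v h = 1 \/ front v g^-1 = 1.

Lemma frontV v g : front v g^-1 = wfront v (word_inv (nf g)).
Proof. by rewrite -{1}[g]nfK -gpw_inv front_gpw // reduced_inv // reduced_nf. Qed.

Lemma no_cancel_reduced g h : no_cancel g h -> reduced (nf g ++ nf h).
Proof.
move=> nc; apply: reduced_cat; rewrite ?reduced_nf // => v.
by rewrite -frontV; exact: nc.
Qed.

Lemma no_cancel_cost c g h : no_cancel g h ->
  cost c (g * h) = (cost c g + cost c h)%N.
Proof.
move=> /no_cancel_reduced red; rewrite -[in LHS](nfK g) -[in LHS](nfK h).
by rewrite -gpw_cat cost_gpw // big_cat.
Qed.

Lemma sub_link v g : (supp g \subset link v) = all (fun b => e v (tag b)) (nf g).
Proof.
apply/supp_subP/allP => gv a /gv; first by rewrite inE.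
by rewrite inE.
Qed.

Lemma no_cancel_front v g h : no_cancel g h ->
  front v (g * h) = if supp g \subset link v then front v h else front v g.
Proof.
move=> /no_cancel_reduced red; rewrite sub_link -[in LHS](nfK g) -[in LHS](nfK h).
by rewrite -gpw_cat front_gpw // wfront_cat.
Qed.

Lemma front_put_gpw v a w : reduced w -> front v (gpw [:: a] * gpw w) = wfront v (put a w).
Proof. by move=> rw; rewrite /front (shuffle_front _ (nf_puts [:: a] rw)). Qed.

Lemma front_inM v (h : H v) g : front v (gp_in e h * g) = h * front v g.
Proof.
rewrite -gpw_syl -{1}[g]nfK front_put_gpw ?reduced_nf // /put /=; case: ifP.
  by move=> /eqP ->; rewrite front_tail_same // reduced_nf.
by rewrite /= eqxx at_vertex_syl.
Qed.

Lemma front1 v : front v 1 = 1.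
Proof. exact: (@front_gpw v [::]). Qed.

Lemma front_in v (h : H v) : front v (gp_in e h) = h.
Proof. by rewrite -[gp_in e h]mulg1 front_inM front1 mulg1. Qed.

Lemma front_supp v g : front v g != 1 -> v \in supp g.
Proof.
rewrite inE; apply: contraR => vg; apply/eqP/wfront_tail1.
apply: contra vg => /hasP[a ain /eqP <-]; exact: map_f.
Qed.

Lemma front_notin v g T : supp g \subset T -> v \notin T -> front v g = 1.
Proof.
move=> /fintype.subsetP gT; apply: contraNeq => /front_supp; exact: gT.
Qed.

Lemma front_decomp v g : exists r, [/\ g = gp_in e (front v g) * r, front v r = 1,
  sylen g = ((front v g != 1%g) + sylen r)%N &
  forall T, supp g \subset T -> supp r \subset T].
Proof.
have rt := reduced_tail v (reduced_nf g).
exists (gpw (wtail v (nf g))); split.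
- by rewrite -gpw_syl -gpw_cons gpw_front nfK.
- by rewrite front_gpw // front_tail_same // reduced_nf.
- by rewrite sylen_gpw // size_tail // reduced_nf.
move=> T /supp_all/allP gT; apply: supp_gpw_sub; apply/allP => a /mem_tail; exact: gT.
Qed.

Lemma gp_in1 v : gp_in e (1 : H v) = 1.
Proof. by rewrite -gpw_syl gpw_one. Qed.

Lemma gp_inM v (h k : H v) : gp_in e (h * k) = gp_in e h * gp_in e k.
Proof. by rewrite -!gpw_syl -gpw_merge gpw_cons. Qed.

Lemma gp_inV v (h : H v) : gp_in e h^-1 = (gp_in e h)^-1.
Proof. by apply: (mulIg (gp_in e h)); rewrite -gp_inM !mulVg gp_in1. Qed.

Lemma gp_in_inj v : injective (@gp_in V e H v).
Proof. by move=> h k hk; rewrite -(front_in h) hk front_in. Qed.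

Lemma commute_supp g h : (forall u v, u \in supp g -> v \in supp h -> e u v) ->
  commute g h.
Proof.
move=> gh; rewrite -[g]nfK -[h]nfK.
have {gh} : {in nf g & nf h, forall a b, e (tag a) (tag b)}.
  by move=> a b ag bh; apply: gh; apply/mem_suppP; [exists a|exists b].
elim: (nf g) => [|a s IHs] gh; first by rewrite gpw_nil; exact/commute_sym/commute1.
rewrite gpw_cons; apply/commute_sym/commuteM; apply/commute_sym; last first.
  by apply: IHs => b c bs; apply: gh; rewrite inE bs orbT.
move: gh => /(_ a _ (mem_head _ _)) {IHs}; elim: (nf h) => [|b t IHt] gh.
  by rewrite gpw_nil; exact: commute1.
rewrite (gpw_cons b); apply: commuteM; first by apply/gpw_comm/gh/mem_head.
by apply: IHt => c ct; apply: gh; rewrite inE ct orbT.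
Qed.

Lemma suppJ g h T : supp g \subset T -> supp h \subset T -> supp (g ^ h) \subset T.
Proof. by move=> gT hT; apply: suppM; [apply: suppV|apply: suppM]. Qed.

Lemma suppVM g h T : supp g \subset T -> supp h \subset T -> supp (g^-1 * h) \subset T.
Proof. by move=> gT hT; apply: suppM; [apply: suppV|]. Qed.

Lemma suppF g h T : supp g \subset T -> supp h \subset T -> supp (g / h) \subset T.
Proof. by move=> gT hT; apply: suppM; [|apply: suppV]. Qed.

(** ** Parabolic cosets *)

(** No syllable over [T] can be split off on the right: this describes the
    shortest elements of the cosets of the parabolic subgroup of [T], which are the
    elements supported in [T], without mentioning lengths. *)
Definition right_min T g := forall v, v \in T -> front v g^-1 = 1.

Lemma right_min_no_cancel T p g : right_min T p -> supp g \subset T -> no_cancel p g.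
Proof.
move=> pT gT v; case: (boolP (v \in T)) => [/pT|vT]; first by right.
by left; exact: front_notin vT.
Qed.

Lemma coset_decomp T g : exists p q, [/\ g = p * q, right_min T p & supp q \subset T].
Proof.
have [n] := ubnP (sylen g); elim: n g => // n IHn g; rewrite ltnS => gn.
case: (boolP [exists v in T, front v g^-1 != 1]) => [/existsP[v /andP[vT fv]]|].
  have [r [Er _ sz _]] := front_decomp v g^-1.
  have lt : (sylen r^-1 < n)%N.
    apply: leq_trans gn; rewrite sylenV -(sylenV g) sz fv; exact: leqnn.
  have [p [q [Ep pT qT]]] := IHn _ lt.
  exists p, (q * (gp_in e (front v g^-1))^-1); split=> //.
    by rewrite mulgA -Ep -invgM -Er invgK.
  by apply: suppM => //; apply/suppV/supp_in.
rewrite negb_exists => /forallP gT; exists g, 1; split; rewrite ?mulg1 ?supp1 //.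
by move=> v vT; have := gT v; rewrite vT negbK => /eqP.
Qed.

Definition bi_min T g := forall v, v \in T -> front v g = 1 /\ front v g^-1 = 1.

Lemma double_coset_decomp T g : exists x (u : G) y,
  [/\ g = x * u * y, bi_min T u, supp x \subset T & supp y \subset T].
Proof.
have [n] := ubnP (sylen g); elim: n g => // n IHn g; rewrite ltnS => gn.
case: (boolP [exists v in T, front v g^-1 != 1]) => [/existsP[v /andP[vT fv]]|].
  have [r [Er _ sz _]] := front_decomp v g^-1.
  have lt : (sylen r^-1 < n)%N.
    apply: leq_trans gn; rewrite sylenV -(sylenV g) sz fv; exact: leqnn.
  have [x [u [y [Ep uT xT yT]]]] := IHn _ lt.
  exists x, u, (y * (gp_in e (front v g^-1))^-1); split=> //.
    by rewrite mulgA -Ep -invgM -Er invgK.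
  by apply: suppM => //; apply/suppV/supp_in.
rewrite negb_exists => /forallP gT.
case: (boolP [exists v in T, front v g != 1]) => [/existsP[v /andP[vT fv]]|].
  have [r [Er _ sz _]] := front_decomp v g.
  have lt : (sylen r < n)%N by apply: leq_trans gn; rewrite sz fv; exact: leqnn.
  have [x [u [y [Ep uT xT yT]]]] := IHn _ lt.
  exists (gp_in e (front v g) * x), u, y; split=> //.
    by rewrite -!mulgA (mulgA x) -Ep -Er.
  by apply: suppM => //; apply/supp_in.
rewrite negb_exists => /forallP gT'; exists 1, g, 1; split; rewrite ?mulg1 ?mul1g ?supp1 //.
move=> v vT; have := gT v; have := gT' v; rewrite vT !negbK => /eqP -> /eqP ->.
by [].
Qed.

(** The first syllable of [z'] is a front of [u * z]. As [u] has no fronts over [T], that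
    syllable comes from [z], passes over all of [u] and therefore commutes with it.
    Removing it from both [z] and [z'] allows an induction. *)
Lemma bi_min_move T (u : G) z z' : bi_min T u ->
  supp z \subset T -> supp z' \subset T -> z' * u = u * z ->
  forall v, v \in supp z -> supp u \subset link v.
Proof.
move=> uT; have [n] := ubnP (sylen z'); elim: n z z' => // n IHn z z'.
rewrite ltnS => z'n zT z'T Ezz.
have nc : no_cancel u z by apply: right_min_no_cancel zT => v /uT[].
have nc' : no_cancel z' u.
  move=> v; case: (boolP (v \in T)) => [/uT[]|vT]; first by left.
  by right; apply: front_notin vT; exact: suppV.
case E: (nf z') => [|[v h] s].
  have z'1 : z' = 1 by rewrite -[z']nfK E.
  move: Ezz; rewrite z'1 mul1g -{1}[u]mulg1 => /mulgI <- v.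
  by move=> /(fintype.subsetP (supp1 finset.set0)); rewrite finset.in_set0.
have h1 : h != 1 by have := reduced_nf z'; rewrite E /= => /and3P[].
have fz' : front v z' = h by rewrite /front E /= eqxx at_vertex_syl.
have vT : v \in T by apply: (fintype.subsetP z'T); apply: front_supp; rewrite fz'.
have nadj : supp z' \subset link v = false.
  by rewrite sub_link E /= e_irr.
have := no_cancel_front v nc'; rewrite nadj Ezz (no_cancel_front v nc) fz'.
case: ifP => [uv fz|_ fu]; last by move: h1; rewrite -fu (uT v vT).1 eqxx.
have cuv : commute (gp_in e h) u.
  apply: commute_supp => a b ah bu.
  have /finset.set1P -> : a \in [set v]%SET.
    by move: a ah; apply/fintype.subsetP/supp_in; rewrite finset.set11.
  by have := fintype.subsetP uv _ bu; rewrite inE.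
have [r' [Er' _ sz' rT']] := front_decomp v z'.
have [r [Er _ _ rT]] := front_decomp v z.
have lt : (sylen r' < n)%N by apply: leq_trans z'n; rewrite sz' fz' h1; exact: leqnn.
have Err : r' * u = u * r.
  apply: (mulgI (gp_in e h)); rewrite !mulgA -fz' -Er' Ezz fz' cuv.
  by rewrite -mulgA; congr (_ * _); rewrite -fz.
move=> a; rewrite Er fz => az.
case: (eqVneq a v) => [->//|nav]; apply: (IHn r r') => //; [exact: rT|exact: rT'|].
apply: contraLR az => ar.
have /contra : a \in supp (gp_in e h * r) -> a \in supp r.
  have : supp (gp_in e h * r) \subset v |: supp r.
    apply: suppM; first by apply: supp_in; rewrite finset.setU11.
    exact: finset.subsetU1.
  by move=> /fintype.subsetP sub /sub; rewrite finset.in_setU1 (negbTE nav).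
exact.
Qed.

(** * Centralisers in an irreducible factor *)

Implicit Types U : {set V}.

Definition nadj : rel V := [rel u v | (u != v) && ~~ e u v].

(** A connected component of the complement graph, or the empty set: the components give
    the finest direct product decomposition that can be read off from the graph. *)
Definition irreducible U := forall u, u \in U -> forall v, (v \in U) = connect nadj u v.

Lemma nadj_sym : symmetric nadj.
Proof. by move=> u v; rewrite /nadj /= eq_sym e_sym. Qed.

Lemma irreducible_nadj U u v : irreducible U -> u \in U -> nadj u v -> v \in U.
Proof. by move=> irr uU uv; rewrite (irr u uU) connect1. Qed.

Lemma irreducible_cut U T u v : irreducible U -> u \in U -> u \in T ->
  v \in U -> v \notin T -> exists a b : V, [/\ a \in T, b \notin T & nadj a b].
Proof.
move=> irr uU uT vU vT; have cs : connect_sym nadj by exact: sym_connect_sym nadj_sym.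
case: (boolP [exists a in T, [exists b, (b \notin T) && nadj a b]]).
  by move=> /existsP[a /andP[aT /existsP[b /andP[bT ab]]]]; exists a, b.
rewrite negb_exists_in => /forall_inP noab.
have cl : fingraph.closed nadj (mem T).
  apply: intro_closed => // a b ab aT; have := noab a aT.
  rewrite negb_exists => /forallP /(_ b); rewrite ab andbT negbK; exact.
have uv : connect nadj u v by rewrite -(irr u uU).
by have := closed_connect cl uv; rewrite uT (negbTE vT).
Qed.

Lemma irreducible_nbr U u : irreducible U -> u \in U -> (1 < #|U|)%N ->
  exists2 v, v \in U & nadj u v.
Proof.
move=> irr uU U2.
have /card_gt0P[v] : (0 < #|U :\ u|)%N by move: U2; rewrite (cardsD1 u U) uU.
rewrite !inE => /andP[vu vU].
have vT : v \notin [set u]%SET by rewrite finset.in_set1.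
have [a [b []]] := irreducible_cut irr uU (finset.set11 u) vU vT.
rewrite finset.in_set1 => /eqP -> _ ub; exists b => //.
exact: irreducible_nadj irr uU ub.
Qed.

(** ** Chains: words in which consecutive syllables never commute *)

Definition chain s := sorted nadj (map (@tag _ _) s) && all (fun a => tagged a != 1) s.

Lemma chain_cons a s : chain (a :: s) -> chain s.
Proof.
by move=> /andP[/= /path_sorted ps /andP[_ s1]]; rewrite /chain ps.
Qed.

Lemma chain_front v a s : chain (a :: s) -> tag a != v -> wfront v (a :: s) = 1.
Proof.
have wfE b t : wfront v (b :: t) =
  if tag b == v then at_vertex v b else if e v (tag b) then wfront v t else 1 by [].
elim: s a => [|b s IHs] a cas av; rewrite wfE (negbTE av); first by case: ifP.
case: ifP => // va; apply: IHs (chain_cons cas) _.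
case/andP: cas => /= /andP[/andP[nab eab] _] _.
by apply: contraNneq eab => ->; rewrite e_sym.
Qed.

Lemma chain_reduced s : chain s -> reduced s.
Proof.
elim: s => //= a s IHs cas; have cs := chain_cons cas.
rewrite IHs // andbT; move: cas cs; case: s {IHs} => [|b s].
  by rewrite /chain /= andbT => ->; rewrite eqxx.
move=> /andP[/= /andP[/andP[nab _] _] /and3P[-> _ _]] cs /=.
by apply/eqP; apply: (chain_front cs); rewrite eq_sym.
Qed.

Lemma chain_inv s : chain s -> chain (word_inv s).
Proof.
move=> /andP[ps s1]; apply/andP; split.
  rewrite /word_inv map_rev -map_comp rev_sorted.
  rewrite -(eq_map (f := @tag _ _)) //.
  by move: ps; apply: sub_sorted => u v; rewrite -nadj_sym.
rewrite /word_inv all_rev all_map; apply: sub_all s1 => a /=.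
by rewrite invg_eq1.
Qed.

Lemma closed_walk U r : irreducible U -> r \in U -> exists p,
  [/\ path nadj r p, last r p = r & {subset U <= r :: p}].
Proof.
move=> irr rU; have cs : connect_sym nadj by exact: sym_connect_sym nadj_sym.
suff [p [pp lp sp]] : exists p, [/\ path nadj r p, last r p = r &
    {subset enum U <= r :: p}].
  by exists p; split=> // u uU; apply: sp; rewrite mem_enum.
have : {subset enum U <= U} by move=> u; rewrite mem_enum.
elim: (enum U) => [_|u us IHu usU]; first by exists [::].
have [|p [pp lp sp]] := IHu; first by move=> v vus; apply: usU; rewrite inE vus orbT.
have uU : u \in U by apply: usU; exact: mem_head.
have /connectP[p1 pp1 lp1] : connect nadj r u by rewrite -(irr r rU).
have /connectP[p2 pp2 lp2] : connect nadj u r by rewrite -(irr u uU).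
exists (p ++ p1 ++ p2); split.
- by rewrite !cat_path lp pp pp1 /= -lp1 pp2.
- by rewrite !last_cat lp -lp1 -lp2.
move=> v; rewrite inE => /predU1P[->|/sp].
  by rewrite lp1 -cat_cons mem_cat (mem_cat _ p1);
     have := mem_last r p1; rewrite inE => /predU1P[->|->];
     rewrite ?mem_head // orbT.
by rewrite -cat_cons mem_cat => ->.
Qed.

Hypothesis H_nontrivial : forall v : V, exists h : H v, h <> 1.

Lemma chain_element U r : irreducible U -> r \in U -> exists t : G,
  supp t = U /\ forall v, v != r -> front v t = 1 /\ front v t^-1 = 1.
Proof.
move=> irr rU; have [p [pp lp sp]] := closed_walk irr rU.
pose letter v : syllable H := syl (sval (cid (H_nontrivial v))).
have letter1 v : tagged (letter v) != 1.
  by rewrite /letter /=; case: cid => h /= /eqP.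
pose s := map letter (r :: p).
have tags : map (@tag _ _) s = r :: p.
  by rewrite /s -map_comp -[RHS]map_id; apply: eq_map.
have cs : chain s.
  rewrite /chain tags; apply/andP; split; first exact: pp.
  by rewrite all_map; apply/allP => v _; exact: letter1.
have rs := chain_reduced cs.
exists (gpw s); split.
  apply/finset.setP => v; rewrite mem_supp_gpw // tags; apply/idP/idP => [|/sp //].
  rewrite inE => /predU1P[->//|vp]; rewrite (irr r rU).
  by apply: (path_connect pp); rewrite inE vp orbT.
move=> v vr; split.
  by rewrite front_gpw // -[s]/(letter r :: map letter p) chain_front // eq_sym.
rewrite -gpw_inv front_gpw; last exact/reduced_inv.
have := chain_inv cs; have : head r (map (@tag _ _) (word_inv s)) = r.
  rewrite /word_inv map_rev -map_comp (eq_map (g := @tag _ _)) // tags.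
  by rewrite lastI lp rev_rcons.
case: (word_inv s) => [//|a s'] /= ar cas.
by apply: (chain_front cas); rewrite ar eq_sym.
Qed.

(** Let [t] be a chain through all of [U] that starts and ends outside [T]. An element of
    the parabolic subgroup of [T] that can be moved across [t] is supported on vertices
    adjacent to all of [U], by [bi_min_move], and is therefore trivial. *)
Lemma chain_separates U T : irreducible U -> T \proper U -> exists t : G,
  supp t \subset U /\
  forall a b a' b' : G, supp a \subset T -> supp b \subset T ->
    supp a' \subset T -> supp b' \subset T ->
    a * t * b = a' * t * b' -> a = a' /\ b = b'.
Proof.
move=> irr /properP[TU [r rU rT]]; have [t [tU tr]] := chain_element irr rU.
exists t; rewrite tU; split=> // a b a' b' aT bT a'T b'T E.
have Emove : (a'^-1 * a) * t = t * (b' * b^-1).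
  by rewrite -mulgA (mulgA t) -(mulgK b (a * t)) E -!mulgA mulKg.
have Tw v : v \in T -> v != r by apply: contraTneq => ->.
have tT : bi_min T t by move=> v /Tw; exact: tr.
have zT : supp (b' / b) \subset T := suppF b'T bT.
have z'T : supp (a'^-1 * a) \subset T := suppVM a'T aT.
have z1 : b' * b^-1 = 1.
  apply: supp_eq1; apply/fintype.subsetP => v vz.
  have := bi_min_move tT zT z'T Emove vz; rewrite tU => /fintype.subsetP/(_ v).
  by rewrite inE e_irr => /(_ (fintype.subsetP TU _ (fintype.subsetP zT _ vz))).
have bb : b = b' by apply/esym/divg1_eq.
by move: E; rewrite bb => /mulIg/mulIg.
Qed.

(** ** Parabolic centralisers *)

Definition in_proper_parabolic U x := exists (q : G) T,
  [/\ supp q \subset U, T \proper U & supp (x ^ q) \subset T].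

(** Let [T] be a smallest set such that [x] is conjugate into the subgroup of [T]. An element
    that centralises this conjugate can leave that subgroup only through vertices
    adjacent to all of [T], by [bi_min_move] and minimality. Such vertices do not
    exhaust the complement of [T] in an irreducible [U]. *)
Lemma centraliser_parabolic U x : irreducible U -> x != 1 -> in_proper_parabolic U x ->
  exists (q : G) T, [/\ supp q \subset U, T \proper U &
    forall y, supp y \subset U -> commute x y -> supp (y ^ q) \subset T].
Proof.
move=> irr x1 [q0 [T0 [q0U T0U xT0]]].
pose P T := `[< T \subset U /\ exists2 q : G, supp q \subset U & supp (x ^ q) \subset T >].
have PT0 : P T0 by apply/asboolP; split; [exact: proper_sub|exists q0].
case: (arg_minnP (fun T : {set V} => #|T|) PT0) => T /asboolP[TU [q qU xT]] minT.
have TpU : T \proper U.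
  by rewrite properEcard TU (leq_ltn_trans (minT _ PT0)) // proper_card.
(* The vertices through which a centralising element may leave [T]. *)
pose L : {set V} := [set v in U | [forall u in T, e u v]].
have TL : (T :|: L)%SET \proper U.
  rewrite properE finset.subUset TU /=; apply/andP; split.
    by apply/fintype.subsetP => v; rewrite inE => /andP[].
  have /finset.set0Pn[u uT] : T != finset.set0.
    apply: contraNneq x1 => T0e; rewrite -(conjg_eq1 x q); apply/eqP/supp_eq1.
    by rewrite -T0e.
  have [_ [v vU vT]] := properP TpU; have uU := fintype.subsetP TU _ uT.
  have [a [b [aT bT /andP[ab nab]]]] := irreducible_cut irr uU uT vU vT.
  apply/negP => /fintype.subsetP/(_ b).
  have abn : nadj a b by rewrite /nadj /= ab nab.
  rewrite (irreducible_nadj irr (fintype.subsetP TU _ aT) abn).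
  move=> /(_ isT); rewrite finset.in_setU (negbTE bT) inE => /andP[_ /forall_inP/(_ a aT)].
  by rewrite (negbTE nab).
exists q, (T :|: L)%SET; split=> // y yU xy.
have xyq : commute (x ^ q) (y ^ q) by rewrite /commute -!conjMg xy.
have yqU : supp (y ^ q) \subset U by exact: suppJ.
have [a [k [b [Ey kT aT bT]]]] := double_coset_decomp T (y ^ q).
have zT : supp (b * x ^ q * b^-1) \subset T := suppF (suppM bT xT) bT.
have z'T : supp (a^-1 * x ^ q * a) \subset T := suppM (suppVM aT xT) aT.
have Ezz : (a^-1 * x ^ q * a) * k = k * (b * x ^ q * b^-1).
  move: xyq; rewrite /commute Ey => Ec.
  apply: (mulgI a); apply: (mulIg b); rewrite !mulgA mulgV mul1g.
  by rewrite -!mulgA mulVg mulg1; move: Ec; rewrite -!mulgA.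
have mv := bi_min_move kT zT z'T Ezz.
have kL : supp k \subset L.
  pose T' : {set V} := [set v in T | supp k \subset link v].
  have PT' : P T'.
    apply/asboolP; split.
      by apply/fintype.subsetP => v; rewrite inE => /andP[/(fintype.subsetP TU)].
    exists (q * b^-1); first by apply: suppF => //; exact: fintype.subset_trans bT TU.
    rewrite conjgM [_ ^ b^-1]conjgE invgK mulgA; apply/fintype.subsetP => v vz.
    by rewrite inE (fintype.subsetP zT _ vz) mv.
  have T'T : T' = T.
    apply/eqP; rewrite eqEcard minT // andbT.
    by apply/fintype.subsetP => v; rewrite inE => /andP[].
  apply/fintype.subsetP => u uk; rewrite inE; apply/andP; split.
    have kU : supp k \subset U.
      have -> : k = a^-1 * y ^ q * b^-1 by rewrite Ey -!mulgA mulgV mulg1 mulKg.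
      by apply: suppF (fintype.subset_trans bT TU); apply: suppVM (fintype.subset_trans aT TU) yqU.
    exact: fintype.subsetP kU _ uk.
  apply/forall_inP => v; rewrite -T'T inE => /andP[_ /fintype.subsetP/(_ u uk)].
  by rewrite inE.
have TTL : T \subset (T :|: L)%SET by exact: finset.subsetUl.
have LTL : L \subset (T :|: L)%SET by exact: finset.subsetUr.
rewrite Ey; apply: suppM (fintype.subset_trans bT TTL).
exact: suppM (fintype.subset_trans aT TTL) (fintype.subset_trans kL LTL).
Qed.

Lemma centraliser_not_parabolic U x y : irreducible U -> supp x \subset U ->
  ~ in_proper_parabolic U x -> y != 1 -> commute x y -> ~ in_proper_parabolic U y.
Proof.
move=> irr xU npx y1 xy py; apply: npx.
have [q [T [qU TU yT]]] := centraliser_parabolic irr y1 py.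
by exists q, T; split=> //; exact: yT (commute_sym xy).
Qed.

(** ** Elements outside all proper parabolic subgroups *)

Definition passes v g : nat := cost (visits v) g.

Lemma passesM v g h : (passes v (g * h) <= passes v g + passes v h)%N.
Proof. exact: costM (seminorm_visits v). Qed.

Lemma passesV v g : passes v g^-1 = passes v g.
Proof. exact: costV (seminorm_visits v). Qed.

Lemma passes_gpw v s : reduced s -> passes v (gpw s) = count (fun a => tag a == v) s.
Proof.
move=> rs; rewrite /passes cost_gpw //; elim: s rs => [|a s IHs] /=.
  by rewrite big_nil.
by move=> /and3P[a1 _ /IHs]; rewrite big_cons => ->; rewrite /visits a1 andbT.
Qed.

Lemma passes_star v g : supp g \subset v |: link v -> (passes v g <= 1)%N.
Proof.
move=> gv; rewrite -[g]nfK passes_gpw ?reduced_nf //.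
have := reduced_nf g; have := supp_all gv; elim: (nf g) => //= a s IHs.
move=> /andP[av sv] /and3P[_ /eqP fa rs].
case: eqVneq => [atv|_]; last by rewrite add0n IHs.
rewrite atv in fa; suff -> : count (fun b => tag b == v) s = 0%N by [].
move: fa sv rs {IHs}; elim: s => //= b s IHs.
case: eqVneq => [btv|nbv] fb /andP[bv sv] /and3P[b1 _ rs].
  by move: b1; rewrite -at_vertexE btv fb eqxx.
move: bv fb; rewrite !inE (negbTE nbv) /= => -> fs; rewrite add0n.
exact: IHs.
Qed.

Lemma passes_gt0 v g : v \in supp g -> (0 < passes v g)%N.
Proof.
move=> /mem_suppP[a ag ->]; rewrite -[g in passes _ g]nfK passes_gpw ?reduced_nf //.
by rewrite -has_count; apply/hasP; exists a.
Qed.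

(** The conjugate [x ^ q] of smallest syllable length has all of [U] as its
    support, and it is cyclically reduced: a syllable that could be merged across
    the boundary of [x ^ q * x ^ q] could be removed by a conjugation.  So the
    normal forms of its powers are concatenated. *)
Lemma not_parabolic_unbounded U x v n : irreducible U -> (1 < #|U|)%N ->
  supp x \subset U -> ~ in_proper_parabolic U x -> v \in U ->
  exists k, (n <= passes v (x ^+ k))%N.
Proof.
move=> irr U2 xU npx vU.
pose P k := `[< exists2 q : G, supp q \subset U & sylen (x ^ q) = k >].
have exP : exists k, P k.
  by exists (sylen (x ^ 1)); apply/asboolP; exists 1; rewrite ?supp1.
case: (ex_minnP exP) => k /asboolP[q qU Ek] mink.
have {}mink (q' : G) : supp q' \subset U -> (k <= sylen (x ^ q'))%N.
  by move=> q'U; apply: mink; apply/asboolP; exists q'.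
set y := x ^ q in Ek.
have yU : supp y \subset U by exact: suppJ.
have syU : supp y = U.
  by apply/eqP; rewrite eqEproper yU /=; apply/negP => yU'; apply: npx; exists q, (supp y).
have Unlink u : u \in U -> (U \subset u |: link u) = false.
  move=> uU; have [w wU /andP[uw nuw]] := irreducible_nbr irr uU U2.
  apply/negP => /fintype.subsetP/(_ w wU).
  by rewrite !inE eq_sym (negbTE uw) (negbTE nuw).
have Ulink u : u \in U -> (supp y \subset link u) = false.
  move=> uU; rewrite syU; apply: contraFF (Unlink u uU) => /fintype.subset_trans; apply.
  exact: finset.subsetUr.
(* A syllable at [u] at both ends would be shortened by conjugation. *)
have ycyc u : front u y = 1 \/ front u y^-1 = 1.
  case: (eqVneq (front u y) 1) => [|f1]; first by left.
  case: (eqVneq (front u y^-1) 1) => [|g1]; first by right.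
  have uU : u \in U by rewrite -syU; exact: front_supp.
  have [r [Ey fr sz rT]] := front_decomp u y; rewrite f1 in sz.
  set h := front u y in f1 Ey; set l := front u y^-1 in g1.
  have hU : supp (gp_in e h) \subset U by exact: supp_in.
  have rU := rT _ yU.
  have ncr : no_cancel r^-1 (gp_in e h)^-1.
    move=> w; case: (eqVneq w u) => [->|wu]; first by right; rewrite invgK.
    left; rewrite -gp_inV; apply: (@front_notin _ _ [set u]%SET).
      by apply: supp_in; rewrite finset.set11.
    by rewrite finset.in_set1.
  have : l != 1 by []; rewrite /l Ey invgM (no_cancel_front _ ncr).
  case: ifP => [ru|_ l1].
    have := Unlink u uU; rewrite -syU Ey.
    rewrite suppM //; first by apply: supp_in; rewrite finset.setU11.
    rewrite -[r]invgK; apply/suppV/(fintype.subset_trans ru).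
    exact: finset.subsetUr.
  have [r' [Er' _ sz' _]] := front_decomp u r^-1.
  set m := front u r^-1 in Er' sz' l1; rewrite l1 in sz'.
  have := mink (q * gp_in e h) (suppM qU hU).
  have -> : x ^ (q * gp_in e h) = r'^-1 * gp_in e (m^-1 * h).
    rewrite conjgM -/y Ey /conjg mulgA mulKg -{1}[r]invgK Er' invgM -mulgA.
    by rewrite -gp_inV -gp_inM.
  rewrite leqNgt => /negP; case; rewrite -Ek sz -(sylenV r) sz'.
  apply: leq_ltn_trans (sylenM _ _) _; rewrite sylenV -gpw_syl.
  have le1 := sylen_gpw_le [:: syl (m^-1 * h)].
  by apply: (@leq_ltn_trans (sylen r' + 1)); rewrite ?leq_add2l // addn1.
have ycyck j : no_cancel y (y ^+ j).
  elim: j => [|j IHj] u; first by left; exact: front1.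
  case: (boolP (u \in U)) => uU; last first.
    left; apply: front_notin uU; elim: (j.+1) => [|i IHi]; first exact: supp1.
    by rewrite expgS; exact: suppM.
  rewrite expgS no_cancel_front // Ulink //; exact: ycyc.
have pky j : passes v (y ^+ j) = (j * passes v y)%N.
  elim: j => [|j IHj]; first exact: cost1.
  by rewrite expgS [LHS](no_cancel_cost _ (ycyck j)) mulSn -IHj.
pose k' := (n + 2 * passes v q)%N; exists k'.
have B : (k' <= passes v (y ^+ k'))%N by rewrite pky leq_pmulr // passes_gt0 // syU.
rewrite -(leq_add2r (2 * passes v q)); apply: leq_trans B _.
rewrite /y -conjXg /conjg; apply: leq_trans (passesM _ _ _) _.
rewrite passesV mul2n -addnn [X in (_ <= X)%N]addnCA leq_add2l.
exact: passesM.
Qed.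

(** ** Walls *)

(** The front at [v] of [q^-1 * g] says on which side of the coset of the parabolic
    subgroup of the star of [v] through [q] the element [g] lies. It changes along
    a path only when the path crosses that coset by a syllable at [v]. *)
Lemma front_step v g a : front v (g * gpw [:: a]) <> front v g ->
  tag a = v /\ supp g \subset v |: link v.
Proof.
case: a => u l; rewrite gpw_syl /=.
have [r [Er fr _ _]] := front_decomp u g^-1; set k := front u g^-1 in Er.
have {}Er : g = r^-1 * gp_in e k^-1 by rewrite -[g]invgK Er invgM gp_inV.
have nc (h : H u) : no_cancel r^-1 (gp_in e h).
  move=> w; case: (eqVneq w u) => [->|wu]; first by right; rewrite invgK.
  left; apply: (@front_notin _ _ [set u]%SET); last by rewrite finset.in_set1.
  by apply: supp_in; rewrite finset.set11.
clearbody k; rewrite Er -mulgA -gp_inM !(no_cancel_front v (nc _)).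
case: ifP => // rv; case: (eqVneq u v) => [uv _|uv].
  split=> //; apply: suppM; last by apply: supp_in; rewrite uv finset.setU11.
  exact: fintype.subset_trans rv (finset.subsetUr _ _).
have f1 (h : H u) : front v (gp_in e h) = 1.
  apply: (@front_notin _ _ [set u]%SET); last by rewrite finset.in_set1 eq_sym.
  by apply: supp_in; rewrite finset.set11.
by rewrite !f1.
Qed.

Lemma front_crossing v g s : front v (g * gpw s) <> front v g ->
  exists s1 a s2, [/\ s = s1 ++ a :: s2, tag a = v &
    supp (g * gpw s1) \subset v |: link v].
Proof.
elim/last_ind: s => [|s a IHs]; first by rewrite gpw_nil mulg1.
rewrite -cats1 gpw_cat mulgA => fsa.
case: (eqVneq (front v (g * gpw s)) (front v g)) => [E|/eqP/IHs].
  move: fsa; rewrite -E => /front_step[av gv]; exists s, a, [::]; split=> //.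
case=> s1 [b [s2 [-> bv gv]]]; exists s1, b, (s2 ++ [:: a]).
by rewrite -catA.
Qed.

(** A syllable at [v] at the end of [s] would merge with [a]. *)
Lemma front_before v s a t : reduced (s ++ a :: t) -> tag a = v ->
  front v (gpw s)^-1 = 1.
Proof.
rewrite -cat1s catA => /reduced_cat_l rsa av; apply/eqP/negPn/negP => f1.
have [r [Er _ sz _]] := front_decomp v (gpw s)^-1.
have rs := reduced_cat_l rsa.
rewrite f1 sylenV sylen_gpw // in sz.
have := sylen_gpw rsa; rewrite gpw_cat -[gpw s]invgK Er invgM -mulgA -gp_inV.
rewrite -(syl_at_vertex av) gpw_syl -gp_inM size_cat /= => Esz.
have := sylenM r^-1 (gp_in e ((front v (gpw s)^-1)^-1 * at_vertex v a)).
rewrite Esz sylenV -gpw_syl.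
have := sylen_gpw_le [:: syl ((front v (gpw s)^-1)^-1 * at_vertex v a)].
rewrite /=; lia.
Qed.

Lemma nth_visit v s n : (n < count (fun a => tag a == v) s)%N ->
  exists s1 a s2, [/\ s = s1 ++ a :: s2, tag a = v &
    count (fun b => tag b == v) s1 = n].
Proof.
elim: s n => //= b s IHs n; case: eqVneq => [bv|bv].
  case: n => [_|n]; first by exists [::], b, s.
  rewrite add1n ltnS => /IHs[s1 [a [s2 [-> av <-]]]].
  by exists (b :: s1), a, s2; rewrite /= bv eqxx.
rewrite add0n => /IHs[s1 [a [s2 [-> av <-]]]].
by exists (b :: s1), a, s2; rewrite /= (negbTE bv).
Qed.

Lemma nth_visit_uniq v s s1 a s2 t1 b t2 : s = s1 ++ a :: s2 -> s = t1 ++ b :: t2 ->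
  tag a = v -> tag b = v ->
  count (fun c => tag c == v) s1 = count (fun c => tag c == v) t1 -> s1 = t1.
Proof.
move=> -> + av bv; elim: s1 t1 => [|c s1 IHs] [|d t1] //=.
- by move=> [<- _]; rewrite av eqxx.
- by move=> [-> _]; rewrite bv eqxx.
by move=> [<- E] /addnI; move=> /(IHs _ E) ->.
Qed.

Lemma passes_prefix v g s t : nf g = s ++ t -> passes v (gpw s) = count (fun a => tag a == v) s.
Proof.
by move=> Eg; apply: passes_gpw; have := reduced_nf g; rewrite Eg => /reduced_cat_l.
Qed.

(** Let [x] be outside all proper parabolic subgroups and let [p] end at a wall in
    the middle of a long power [g] of [x]. An element [y] of the centraliser with few
    syllables at [v] moves [g] to [y * g = g * y], a path that differs from [g] only
    near its ends; so it moves the wall of [p] to another wall crossed by [g], close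
    to the first. As nontrivial elements of the centraliser stabilise no wall, [y] is
    determined by the position of that wall. *)
Lemma centraliser_walls U x v m : irreducible U -> (1 < #|U|)%N ->
  supp x \subset U -> ~ in_proper_parabolic U x -> v \in U ->
  exists f : G -> nat,
    (forall y, commute x y -> (passes v y <= m)%N -> (f y <= 2 * m + 3)%N) /\
    (forall y z, commute x y -> commute x z -> supp y \subset U -> supp z \subset U ->
      (passes v y <= m)%N -> (passes v z <= m)%N -> f y = f z -> y = z).
Proof.
move=> irr U2 xU npx vU.
have [k kx] := not_parabolic_unbounded (4 * m + 8)%N irr U2 xU npx vU.
set g := x ^+ k in kx.
have gU : supp g \subset U.
  by rewrite /g; elim: (k) => [|i IHi]; [exact: supp1|rewrite expgS; exact: suppM].
have rg := reduced_nf g.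
have cg : count (fun a => tag a == v) (nf g) = passes v g.
  by rewrite -passes_gpw // nfK.
have [|s1 [a [s2 [Eg av cs1]]]] := @nth_visit v (nf g) m.+2.
  by rewrite cg; apply: leq_trans kx; lia.
have rg' : reduced (s1 ++ a :: s2) by rewrite -Eg.
have cs2 : (2 * m + 2 <= count (fun a => tag a == v) s2)%N.
  by move: kx; rewrite -cg Eg count_cat cs1 /= av eqxx; lia.
set p := gpw s1.
have lp : passes v p = m.+2 by rewrite (passes_prefix v Eg).
have pg : p^-1 * g = gpw (a :: s2) by rewrite -[g]nfK Eg gpw_cat mulKg.
have lpg : (2 * m + 3 <= passes v (p^-1 * g))%N.
  by rewrite pg (passes_gpw _ (reduced_cat_r rg')) /= av eqxx add1n addnS ltnS; exact: cs2.
have fpg : front v (p^-1 * g) <> front v p^-1.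
  rewrite (front_before rg' av) pg front_gpw ?(reduced_cat_r rg') //= av eqxx.
  have a1 : tagged a != 1 by apply: (reduced_neq1 rg'); rewrite mem_cat mem_head orbT.
  by move: a1; rewrite -at_vertexE av => /eqP.
have pU : supp p \subset U.
  apply: supp_gpw_sub; apply/allP => b bs1; apply: (supp_subP g U gU).
  by rewrite Eg mem_cat bs1.
(* A wall of [g] that is the image under [y] of the wall of [p]. *)
have hit y : commute x y -> (passes v y <= m)%N ->
    exists t, [/\ exists b t2, nf g = t ++ b :: t2 /\ tag b = v,
      supp ((y * p)^-1 * gpw t) \subset v |: link v &
      (count (fun a => tag a == v) t <= 2 * m + 3)%N].
  move=> xy ym; have yg : y * g = g * y.
    exact/commuteX/commute_sym.
  (* [p] is too deep for its wall to be crossed on the way from 1 to [y^-1]. *)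
  have n1 : front v ((y * p)^-1 * y) = front v (y * p)^-1.
    apply/eqP/negPn/negP => /eqP; rewrite invgM -mulgA mulVg mulg1 => ne.
    have [|t [b [t2 [Ey bv pt]]]] := @front_crossing v p^-1 (nf y^-1).
      by rewrite nfK => /esym.
    have ct : (passes v (gpw t) <= m)%N.
      rewrite (passes_prefix v Ey); apply: leq_trans ym.
      by rewrite -passesV -[y^-1]nfK passes_gpw ?reduced_nf // Ey count_cat leq_addr.
    have := passesM v (gpw t) (p^-1 * gpw t)^-1.
    rewrite invgM invgK mulgA mulgV mul1g lp -{1}[p]invgK -invgM passesV.
    have := passes_star pt; move: ct.
    by move=> c1 c2; apply/negP; rewrite -leqNgt -addn1; exact: leq_add.
  (* Nor is the wall of [y * p] crossed between [g] and [g * y]: the rest of [g] after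
     [p] is long as well. *)
  have n2 : front v ((y * p)^-1 * (y * g)) = front v ((y * p)^-1 * g).
    apply/eqP/negPn/negP => /eqP; rewrite yg mulgA => ne.
    have [|t [b [t2 [Ey bv pt]]]] := @front_crossing v ((y * p)^-1 * g) (nf y).
      by rewrite nfK.
    have ct : (passes v (gpw t) <= m)%N.
      rewrite (passes_prefix v Ey); apply: leq_trans ym.
      by rewrite -[y in passes v y]nfK passes_gpw ?reduced_nf // Ey count_cat leq_addr.
    have Epg : p^-1 * g = ((y * p)^-1 * g * gpw t) * ((gpw t)^-1 * y).
      rewrite -!mulgA mulVKg -yg invgM -!mulgA mulKg //.
    have c1 : (passes v ((gpw t)^-1 * y) <= m + m)%N.
      by apply: leq_trans (passesM _ _ _) _; rewrite passesV leq_add.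
    have : (passes v (p^-1 * g) <= 1 + (m + m))%N.
      by rewrite Epg; exact: leq_trans (passesM _ _ _) (leq_add (passes_star pt) c1).
    move=> /(leq_trans lpg); clear; lia.
  have ne : front v ((y * p)^-1 * gpw (nf g)) <> front v (y * p)^-1.
    by rewrite nfK -n2 -n1 invgM -!mulgA !mulKg mulVg mulg1.
  have [t [b [t2 [Et bv pt]]]] := front_crossing ne.
  exists t; split; [by exists b, t2|exact: pt|].
  rewrite -(passes_prefix v Et).
  have -> : gpw t = (y * p) * ((y * p)^-1 * gpw t) by rewrite mulVKg.
  have c1 : (passes v (y * p) <= m + m.+2)%N.
    by apply: leq_trans (passesM _ _ _) _; rewrite lp leq_add2r.
  apply: leq_trans (passesM _ _ _) _.
  by apply: leq_trans (leq_add c1 (passes_star pt)) _; clear; lia.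
pose P y t := [/\ exists b t2, nf g = t ++ b :: t2 /\ tag b = v,
      supp ((y * p)^-1 * gpw t) \subset v |: link v &
      (count (fun a => tag a == v) t <= 2 * m + 3)%N].
pose f y := if pselect (exists t, P y t) is left ex
  then count (fun a => tag a == v) (sval (cid ex)) else 0%N.
have fP y : commute x y -> (passes v y <= m)%N ->
    exists2 t, P y t & f y = count (fun a => tag a == v) t.
  move=> xy ym; rewrite /f; case: pselect => [ex|[]]; last exact: hit.
  by case: (cid ex) => t Pt /=; exists t.
exists f; split=> [y xy ym|y z xy xz yU zU ym zm].
  by have [t [_ _ ct] ->] := fP y xy ym.
have [t [[b [t2 [Et bv]]] pt _] ->] := fP y xy ym.
have [t' [[b' [t2' [Et' bv']]] pt' _] ->] := fP z xz zm.
move=> /(nth_visit_uniq Et Et' bv bv') tt'; rewrite -{t' Et'}tt' in pt'.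
apply/esym/eqP; rewrite -(inj_eq (mulgI y^-1)) mulVg.
apply/negPn/negP => zy1.
have xzy : commute x (y^-1 * z).
  by apply: commuteM => //; exact: commuteV.
apply: (centraliser_not_parabolic irr xU npx zy1 xzy).
exists p, (U :&: (v |: link v))%SET; split=> //.
  rewrite properE finset.subsetIl /=; apply/negP; rewrite finset.subsetI => /andP[_].
  have [w wU /andP[vw nvw]] := irreducible_nbr irr vU U2.
  move=> /fintype.subsetP/(_ w wU).
  by rewrite !inE eq_sym (negbTE vw) (negbTE nvw).
rewrite finset.subsetI; apply/andP; split; first exact: suppJ (suppVM yU zU) pU.
have -> : (y^-1 * z) ^ p = ((y * p)^-1 * gpw t) * ((z * p)^-1 * gpw t)^-1.
  by rewrite /conjg !invgM !invgK -!mulgA mulVKg.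
exact: suppF.
Qed.

(** * Word length and balls *)

Variable X : forall v : V, set (H v).
Arguments X : clear implicits.
Hypothesis X_gen : forall v, finite_generating_set (X v).

Definition syl_len a : nat := word_length (X (tag a)) (tagged a).
Definition len g : nat := cost syl_len g.

Lemma X_generates v : generates (X v). Proof. by case: (X_gen v). Qed.

Lemma seminorm_syl_len : seminorm syl_len.
Proof.
split=> [v|v h k|v h]; rewrite /syl_len /=.
- exact: word_length1 (@X_generates v).
- exact: word_lengthM (@X_generates v) _ _.
- exact: word_lengthV (@X_generates v) _.
Qed.

Lemma lenM g h : (len (g * h) <= len g + len h)%N.
Proof. exact: costM seminorm_syl_len. Qed.

Lemma lenV g : len g^-1 = len g.
Proof. exact: costV seminorm_syl_len. Qed.

Lemma len1 : len 1 = 0%N. Proof. exact: cost1. Qed.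

Lemma len_in v (h : H v) : len (gp_in e h) = word_length (X v) h.
Proof. by rewrite /len (cost_in _ seminorm_syl_len). Qed.

Lemma len_gen x : gp_gens e X x \/ gp_gens e X x^-1 -> (len x <= 1)%N.
Proof.
by case=> -[v _ [h Xh Eh]]; [|rewrite -lenV]; rewrite -Eh len_in;
  apply: word_length_gen (@X_generates v) _ _; left.
Qed.

(** Geodesics can be taken over the support of an element: so cutting them does not
    leave a parabolic subgroup. *)
Lemma spell s : exists w : seq G, [/\ represents (gp_gens e X) w (gpw s),
  size w = (\sum_(a <- s) syl_len a)%N &
  forall T x, all (fun a => tag a \in T) s -> x \in w -> supp x \subset T].
Proof.
elim: s => [|[v h] s [w [rw sw Tw]]].
  by exists [::]; split; rewrite ?big_nil //; split=> //; rewrite big_nil.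
have [[w' [Xw' Ew'] sw'] _] := word_lengthP (@X_generates v) h.
have r1 : represents (gp_gens e X) (map (@gp_in V e H v) w') (gpw [:: syl h]).
  split=> [_ /mapP[k /Xw'[Xk|Xk] ->]|].
  - by left; exists v => //; exists k.
  - by right; rewrite -gp_inV; exists v => //; exists k^-1.
  rewrite gpw_syl -Ew'; elim: w' {Xw' Ew' sw'} => [|k w' IHw].
    by rewrite !big_nil gp_in1.
  by rewrite /= !big_cons gp_inM IHw.
exists (map (@gp_in V e H v) w' ++ w); split.
- by rewrite gpw_cons; exact: represents_cat.
- by rewrite size_cat size_map big_cons sw sw'.
move=> T x /= /andP[vT sT]; rewrite mem_cat => /orP[/mapP[k _ ->]|]; last exact: Tw.
exact: supp_in.
Qed.

Lemma gp_gens_generate : generates (gp_gens e X).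
Proof. by move=> g; have [w [rw _ _]] := spell (nf g); exists w; rewrite nfK in rw. Qed.

Lemma represents_len (w : seq G) g : represents (gp_gens e X) w g -> (len g <= size w)%N.
Proof.
move=> [Xw <-]; elim: w Xw => [|x w IHw] Xw; first by rewrite big_nil len1.
rewrite big_cons; apply: leq_trans (lenM _ _) _; rewrite /= -add1n; apply: leq_add.
  by apply/len_gen/Xw/mem_head.
by apply: IHw => y yw; apply: Xw; rewrite inE yw orbT.
Qed.

(** The word length of a graph product adds up the word lengths of the syllables of
    a normal form, since a generator changes the length of one syllable only. *)
Lemma word_length_len g : word_length (gp_gens e X) g = len g.
Proof.
apply/eqP; rewrite eqn_leq; apply/andP; split.
  have [w [rw sw _]] := spell (nf g); rewrite nfK in rw.
  by rewrite /len /cost -sw; exact: word_length_min gp_gens_generate _ _ rw.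
have [[w rw <-] _] := word_lengthP gp_gens_generate g.
exact: represents_len.
Qed.

Lemma gp_gens_finite : finite_set (gp_gens e X).
Proof.
apply: bigcup_finite; first exact: finite_finset.
by move=> v _; apply: finite_image; case: (X_gen v).
Qed.

Lemma len_split T g k : supp g \subset T -> (k <= len g)%N -> exists g1 g2,
  [/\ g = g1 * g2, len g1 = k, len g2 = (len g - k)%N &
      supp g1 \subset T /\ supp g2 \subset T].
Proof.
move=> gT kg; have [w [[Xw Ew] sw Tw]] := spell (nf g); rewrite nfK in Ew.
have {}Tw x : x \in w -> supp x \subset T by apply: Tw; exact: supp_all.
have {}sw : size w = len g by [].
have rep (w' : seq G) : {subset w' <= w} -> represents (gp_gens e X) w' (\prod_(x <- w') x).
  by move=> w'w; split=> // x /w'w/Xw.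
have supw (w' : seq G) : {subset w' <= w} -> supp (\prod_(x <- w') x) \subset T.
  elim: w' => [|x w' IHw] w'w; first by rewrite big_nil supp1.
  rewrite big_cons; apply: suppM; first by apply/Tw/w'w/mem_head.
  by apply: IHw => y yw'; apply: w'w; rewrite inE yw' orbT.
have tw : {subset take k w <= w} by move=> x; exact: mem_take.
have dw : {subset drop k w <= w} by move=> x; exact: mem_drop.
have Eg : g = (\prod_(x <- take k w) x) * (\prod_(x <- drop k w) x).
  by rewrite -[LHS]Ew -big_cat cat_take_drop.
have l1 := represents_len (rep _ tw); have l2 := represents_len (rep _ dw).
have := lenM (\prod_(x <- take k w) x) (\prod_(x <- drop k w) x); rewrite -Eg.
rewrite size_takel ?sw // in l1; rewrite size_drop sw in l2 => l3.
exists (\prod_(x <- take k w) x), (\prod_(x <- drop k w) x); split=> //.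
- by apply/eqP; rewrite eqn_leq l1 -(leq_add2r (len g - k)) subnKC //; apply: leq_trans l3 _; rewrite leq_add2l.
- by apply/eqP; rewrite eqn_leq l2 leq_subLR; apply: leq_trans l3 _; rewrite leq_add2r.
by split; exact: supw.
Qed.

Definition ball T n : set G := [set g | supp g \subset T /\ (len g <= n)%N].
Definition sphere T n : set G := [set g | supp g \subset T /\ len g = n].
Definition ballc T n : nat := finite_card (ball T n).
Definition spherec T n : nat := finite_card (sphere T n).

Lemma gball_ball n : gball (gp_gens e X) n = ball finset.setT n.
Proof.
apply/seteqP; split=> g; rewrite /gball /ball /= word_length_len; last by case.
by move=> gn; split=> //; exact: finset.subsetT.
Qed.

Lemma ball_finite T n : finite_set (ball T n).
Proof.
apply: sub_finite_set (gball_finite gp_gens_generate n gp_gens_finite) => g [_ gn].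
by rewrite /gball /= word_length_len.
Qed.

Lemma sphere_finite T n : finite_set (sphere T n).
Proof. by apply: sub_finite_set (@ball_finite T n) => g [gT gn]; split; rewrite ?gn. Qed.

Lemma ballc_sub T T' n : T \subset T' -> (ballc T n <= ballc T' n)%N.
Proof.
move=> TT'; apply: card_subset (@ball_finite _ _) _ => g [gT gn]; split=> //.
exact: fintype.subset_trans TT'.
Qed.

Lemma ballc_mono T m n : (m <= n)%N -> (ballc T m <= ballc T n)%N.
Proof.
move=> mn; apply: card_subset (@ball_finite _ _) _ => g [gT gn]; split=> //.
exact: leq_trans mn.
Qed.

Lemma ballc_gt0 T n : (0 < ballc T n)%N.
Proof.
have -> : 1%N = finite_card [set (1 : G)] by rewrite /finite_card fset_set1 cardfs1.
apply: card_subset (@ball_finite _ _) _ => _ ->; split; first exact: supp1.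
by rewrite len1.
Qed.

(** Geodesics can be cut anywhere, so that a long element is a product of two shorter
    ones. *)
Lemma ballcM T m n : (ballc T (m + n) <= ballc T m * ballc T n)%N.
Proof.
rewrite /ballc -card_setX; try exact: ball_finite.
have cutP g : ball T (m + n) g -> exists u : G * G, [/\ ball T m u.1, ball T n u.2 & u.1 * u.2 = g].
  move=> [gT gmn]; case: (leqP (len g) m) => gm.
    exists (g, 1); split; rewrite /= ?mulg1 //; split; rewrite ?len1 //; exact: supp1.
  have [g1 [g2 [Eg l1 l2 [s1 s2]]]] := len_split gT (ltnW gm).
  by exists (g1, g2); split=> //; split; rewrite ?l1 ?l2 // leq_subLR.
pose f g : G * G := if pselect (exists u : G * G, [/\ ball T m u.1, ball T n u.2 & u.1 * u.2 = g])
  is left ex then sval (cid ex) else (1, 1).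
have fP g : ball T (m + n) g -> [/\ ball T m (f g).1, ball T n (f g).2 & (f g).1 * (f g).2 = g].
  by move=> /cutP ex; rewrite /f; case: pselect => // ex'; case: cid.
apply: (@card_injection _ _ _ _ f).
- exact: ball_finite.
- by apply: finite_setX; exact: ball_finite.
- by move=> g /fP[? ? _]; split.
by move=> g h /fP[_ _ Eg] /fP[_ _ Eh] E; rewrite -[LHS]Eg E.
Qed.

Lemma ballc_slices T n : ballc T n = (\sum_(k < n.+1) spherec T k)%N.
Proof.
rewrite /ballc (@card_slices _ _ len n (@ball_finite _ _)) => [|g []//].
apply: eq_bigr => k _; congr finite_card; apply/seteqP; split=> g [].
  by move=> [gT _] gk; split.
by move=> gT gk; split=> //; split=> //; rewrite gk -ltnS.
Qed.

Lemma spherecE T n : ballc T n.+1 = (ballc T n + spherec T n.+1)%N.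
Proof. by rewrite !ballc_slices big_ord_recr. Qed.

(** ** Direct products *)

Definition joined T T' := forall u v, u \in T -> v \in T' -> e u v.

Definition prj T g : G := gpw [seq a <- nf g | tag a \in T].

Lemma supp_prj T g : supp (prj T g) \subset T.
Proof. by apply: supp_gpw_sub; exact: filter_all. Qed.

Lemma joined_disjoint T T' v : joined T T' -> v \in T -> v \in T' -> False.
Proof. by move=> TT' vT vT'; have := TT' v v vT vT'; rewrite e_irr. Qed.

Lemma joined_sym T T' : joined T T' -> joined T' T.
Proof. by move=> TT' u v uT' vT; rewrite e_sym; exact: TT'. Qed.

Lemma joined_commute T T' g h : joined T T' -> supp g \subset T -> supp h \subset T' ->
  commute g h.
Proof.
move=> TT' /fintype.subsetP gT /fintype.subsetP hT'; apply: commute_supp => u v.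
by move=> /gT uT /hT'; exact: TT'.
Qed.

Lemma prj_mul T T' g : joined T T' -> supp g \subset T :|: T' -> g = prj T g * prj T' g.
Proof.
move=> TT' /supp_all gTT'; rewrite -[LHS]nfK /prj.
elim: (nf g) gTT' => [|a s IHs] /=; first by rewrite mulg1.
rewrite finset.in_setU => /andP[aTT' /IHs E]; rewrite gpw_cons E.
case: ifPn => aT; case: ifPn => aT'.
- by case: (joined_disjoint TT' aT aT').
- by rewrite [in RHS]gpw_cons mulgA.
- rewrite [gpw (a :: [seq b <- s | tag b \in T'])]gpw_cons !mulgA; congr (_ * _).
  have := @joined_commute T T' (gpw [seq b <- s | tag b \in T]) (gpw [:: a]) TT'.
  by move=> -> //; apply: supp_gpw_sub; rewrite ?filter_all //= aT'.
by rewrite (negbTE aT) (negbTE aT') in aTT'.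
Qed.

Lemma joined_inj T T' g h g' h' : joined T T' -> supp g \subset T -> supp g' \subset T ->
  supp h \subset T' -> supp h' \subset T' -> g * h = g' * h' -> g = g' /\ h = h'.
Proof.
move=> TT' gT g'T hT' h'T' E.
have E1 : g'^-1 * g = h' / h by rewrite -[g](mulgK h) E mulgA mulKg.
have gg : g'^-1 * g = 1.
  apply: supp_eq1; apply/fintype.subsetP => v vg.
  case: (@joined_disjoint T T' v TT').
    exact: fintype.subsetP (suppVM g'T gT) _ vg.
  by rewrite E1 in vg; exact: fintype.subsetP (suppF h'T' hT') _ vg.
have Eg : g = g' by rewrite -(mulVKg g' g) gg mulg1.
by split=> //; apply: (mulgI g); rewrite E Eg.
Qed.

Lemma prjM T T' g h : joined T T' -> supp g \subset T -> supp h \subset T' ->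
  prj T (g * h) = g /\ prj T' (g * h) = h.
Proof.
move=> TT' gT hT'; have := @prj_mul T T' (g * h) TT'.
rewrite suppM; first 1 last.
- exact: fintype.subset_trans gT (finset.subsetUl _ _).
- exact: fintype.subset_trans hT' (finset.subsetUr _ _).
move=> /(_ isT)/esym/(joined_inj TT' (supp_prj _ _) gT (supp_prj _ _) hT').
exact.
Qed.

Lemma joined_no_cancel T T' g h : joined T T' -> supp g \subset T -> supp h \subset T' ->
  no_cancel g h.
Proof.
move=> TT' gT hT'; apply: right_min_no_cancel hT' => v vT'.
by apply: front_notin (suppV gT) _; apply/negP => vT; exact: joined_disjoint TT' vT vT'.
Qed.

Lemma len_joined T T' g h : joined T T' -> supp g \subset T -> supp h \subset T' ->
  len (g * h) = (len g + len h)%N.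
Proof. by move=> TT' gT hT'; apply/no_cancel_cost/(joined_no_cancel TT' gT hT'). Qed.

Lemma len_prj T T' g : joined T T' -> supp g \subset T :|: T' ->
  len g = (len (prj T g) + len (prj T' g))%N.
Proof.
move=> TT' gTT'; rewrite {1}(prj_mul TT' gTT').
exact: len_joined TT' (supp_prj _ _) (supp_prj _ _).
Qed.

Lemma prj_commute T T' x y : joined T T' -> supp x \subset T :|: T' ->
  supp y \subset T :|: T' -> commute x y -> commute (prj T x) (prj T y).
Proof.
move=> TT' xTT' yTT' xy.
have cm g h : commute (prj T' g) (prj T h).
  exact/commute_sym/(joined_commute TT' (supp_prj _ _) (supp_prj _ _)).
have E g h : supp g \subset T :|: T' -> supp h \subset T :|: T' ->
    g * h = (prj T g * prj T h) * (prj T' g * prj T' h).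
  move=> gT hT; rewrite {1}(prj_mul TT' gT) {1}(prj_mul TT' hT).
  by rewrite -!mulgA (mulgA (prj T' g)) cm -mulgA.
move: xy; rewrite /commute (E x y) // (E y x) //.
have sT g h : supp (prj T g * prj T h) \subset T by apply: suppM; exact: supp_prj.
have sT' g h : supp (prj T' g * prj T' h) \subset T' by apply: suppM; exact: supp_prj.
by move=> /(joined_inj TT' (sT _ _) (sT _ _) (sT' _ _) (sT' _ _))[].
Qed.

(** The word length of a direct product is the sum of the lengths of the two
    projections. *)
Lemma ballc_joined T T' n : joined T T' ->
  ballc (T :|: T') n = (\sum_(k < n.+1) spherec T k * ballc T' (n - k))%N.
Proof.
move=> TT'.
have sU := finset.subsetUl T T'; have sU' := finset.subsetUr T T'.
rewrite /ballc (@card_slices _ _ (fun g => len (prj T g)) n (@ball_finite _ _)); last first.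
  by move=> g [gT gn]; apply: leq_trans gn; rewrite (len_prj TT' gT) leq_addr.
apply: eq_bigr => k _; rewrite -card_setX; [|exact: sphere_finite|exact: ball_finite].
have fS : finite_set (sphere T k `*` ball T' (n - k)).
  by apply: finite_setX; [exact: sphere_finite|exact: ball_finite].
have fB : finite_set (ball (T :|: T') n `&` [set g | len (prj T g) = k]).
  by apply: sub_finite_set (@ball_finite (T :|: T') n) => g [].
have kn : (k <= n)%N by rewrite -ltnS.
apply/eqP; rewrite eqn_leq; apply/andP; split.
  apply: (@card_injection _ _ _ _ (fun g => (prj T g, prj T' g))) => //.
    move=> g [[gT gn] gk]; split; split=> //=; try exact: supp_prj.
    by rewrite -(leq_add2l k) -{1}gk -(len_prj TT' gT) subnKC.
  move=> g h [[gT _] _] [[hT _] _] [E1 E2].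
  by rewrite (prj_mul TT' gT) (prj_mul TT' hT) E1 E2.
apply: (@card_injection _ _ _ _ (fun u : G * G => u.1 * u.2)) => //.
  move=> [g h] [[/= gT gk] [/= hT' hn]]; split.
    split; first by apply: suppM; [exact: fintype.subset_trans sU|exact: fintype.subset_trans sU'].
    by rewrite (len_joined TT' gT hT') gk -leq_subRL.
  by rewrite /= (prjM TT' gT hT').1.
move=> [g h] [g' h'] [[/= gT gk] [/= hT' hn]] [[/= g'T g'k] [/= h'T' h'n]].
by move=> /(joined_inj TT' gT g'T hT' h'T')[-> ->].
Qed.

(** * Centralisers and parabolic subgroups are negligible *)

Lemma card_II n : finite_card `I_n = n.
Proof. by apply: card_fset_set; exact: card_eqxx. Qed.

(** Cutting the elements of the subgroup of [T] at a point of their geodesics and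
    inserting there a chain through [U] is injective, and there are as many points to
    cut as the length allows: so the long elements of this subgroup are few among all
    elements over [U]. *)
Lemma parabolic_sparse U T : irreducible U -> T \proper U -> exists M, forall L m,
  (ballc T m * L <= ballc U L * L + M * ballc U m)%N.
Proof.
move=> irr TU; have [t [tU sep]] := chain_separates irr TU.
exists (ballc U (len t)) => L m.
pose A : set G := [set y | ball T m y /\ (L <= len y)%N].
have fA : finite_set A by apply: sub_finite_set (@ball_finite T m) => y [].
have TU' := proper_sub TU.
have bA : (ballc T m <= ballc U L + finite_card A)%N.
  apply: leq_trans (card_setU (@ball_finite U L) fA).
  apply: card_subset; first by rewrite finite_setU; split=> //; exact: ball_finite.
  move=> y [yT ym]; case: (leqP L (len y)) => yL; first by right.
  by left; split; [exact: fintype.subset_trans TU'|exact: ltnW].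
apply: leq_trans (leq_mul bA (leqnn L)) _; rewrite mulnDl leq_add2l.
rewrite [X in (_ <= X)%N]mulnC; apply: leq_trans (ballcM U m (len t)).
rewrite -{1}(card_II L) -card_setX //.
pose cut (u : G * nat) (z : G * G) := [/\ u.1 = z.1 * z.2, len z.1 = u.2,
  supp z.1 \subset T, supp z.2 \subset T & (len z.1 + len z.2 <= m)%N].
have cutP (u : G * nat) : (A `*` `I_L) u -> exists z : G * G, cut u z.
  case: u => y k [/= [[yT ym] yL] kL].
  have ky : (k <= len y)%N by apply: leq_trans yL; exact: ltnW.
  have [g1 [g2 [Ey l1 l2 [s1 s2]]]] := len_split yT ky.
  by exists (g1, g2); split; rewrite //= l1 l2 subnKC.
pose f (u : G * nat) : G := if pselect (exists z : G * G, cut u z) is left ex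
  then (sval (cid ex)).1 * t * (sval (cid ex)).2 else 1.
have fP (u : G * nat) : (A `*` `I_L) u -> exists2 z : G * G, cut u z & f u = z.1 * t * z.2.
  move=> /cutP ex; rewrite /f; case: pselect => // ex'; case: (cid ex') => z cz /=.
  by exists z.
apply: (@card_injection _ _ _ _ f).
- by apply: finite_setX => //; exact: finite_II.
- exact: ball_finite.
- move=> u /fP[z [_ _ z1 z2 lz] ->]; split.
    apply: suppM (fintype.subset_trans z2 TU').
    exact: suppM (fintype.subset_trans z1 TU') tU.
  apply: leq_trans (lenM _ _) _; rewrite -(leq_add2r (len t)) in lz.
  apply: leq_trans lz; rewrite addnAC leq_add2r; exact: lenM.
move=> [y k] [y' k'] /fP [z [Ey Ek z1 z2 _] Ef] /fP [z' [Ey' Ek' z1' z2' _] Ef'] E.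
have [E1 E2] : z.1 = z'.1 /\ z.2 = z'.2 by apply: sep; rewrite // -Ef -Ef'.
by move: Ey Ek Ey' Ek'; rewrite /= E1 E2 => -> <- -> <-.
Qed.

Definition centc U x m : nat := finite_card (ball U m `&` centraliser x).

Lemma centc_finite U x m : finite_set (ball U m `&` centraliser x).
Proof. by apply: sub_finite_set (@ball_finite U m) => g []. Qed.

(** Conjugation by the shortest element [p] of the coset of [q] does not lengthen the
    elements of this set, as lengths add up in [p * y ^ p = y * p]. *)
Lemma conjugate_ballc T U (q : G) m :
  (finite_card (ball U m `&` [set y | supp (y ^ q) \subset T]) <= ballc T m)%N.
Proof.
have [p [s [Eq pT sT]]] := coset_decomp T q.
apply: (@card_injection _ _ _ _ (fun y => y ^ p)).
- by apply: sub_finite_set (@ball_finite U m) => g [].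
- exact: ball_finite.
- move=> y [[_ ym] /= yT].
  have yp : supp (y ^ p) \subset T.
    have -> : p = q * s^-1 by rewrite Eq mulgK.
    by rewrite conjgM; apply: suppJ yT _; exact: suppV.
  split=> //; rewrite -(leq_add2l (len p)) -(no_cancel_cost _ (right_min_no_cancel pT yp)).
  rewrite -conjgC; apply: leq_trans (lenM _ _) _; rewrite addnC leq_add2l.
  exact: ym.
by move=> y z _ _ /conjg_inj.
Qed.

Lemma passes_len v g : (passes v g <= len g)%N.
Proof.
rewrite /passes /len /cost; apply: leq_sum => a _; rewrite /visits /syl_len.
case: eqP => //= _; case: eqP => // a1; rewrite lt0n; apply/eqP.
by move=> /(word_length_eq0 (@X_generates _)).
Qed.

Lemma centc_bound U x : irreducible U -> (1 < #|U|)%N -> supp x \subset U -> x != 1 ->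
  (exists2 T : {set V}, T \proper U & forall m, (centc U x m <= ballc T m)%N) \/
  (forall m, (centc U x m <= 2 * m + 4)%N).
Proof.
move=> irr U2 xU x1; case: (pselect (in_proper_parabolic U x)) => [px|npx].
  left; have [q [T [qU TU cT]]] := centraliser_parabolic irr x1 px.
  exists T => // m; apply: leq_trans (conjugate_ballc T U q m).
  apply: card_subset; first by apply: sub_finite_set (@ball_finite U m) => g [].
  by move=> y [[yU ym] xy]; split=> //; exact: cT.
right=> m; have [v vU] : exists v, v \in U by apply/card_gt0P; exact: ltnW.
have [f [fm finj]] := centraliser_walls m irr U2 xU npx vU.
rewrite -(card_II (2 * m + 4)); apply: (@card_injection _ _ _ _ f).
- exact: centc_finite.
- exact: finite_II.
- move=> y [[yU ym] xy] /=; rewrite addnS ltnS; apply: fm => //.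
  exact: leq_trans (passes_len _ _) ym.
move=> y z [[yU ym] xy] [[zU zm] xz]; apply: finj => //.
  exact: leq_trans (passes_len _ _) ym.
exact: leq_trans (passes_len _ _) zm.
Qed.

Lemma supp_vertex v g : supp g \subset [set v]%SET -> g = gp_in e (front v g).
Proof.
move=> gv; have [r [Eg fr _ rv]] := front_decomp v g.
rewrite {1}Eg; suff -> : r = 1 by rewrite mulg1.
have {}rv := rv _ gv; apply/eqP; apply: contraT => r1.
case E: (nf r) => [|[u h] s]; first by rewrite -[r]nfK E eqxx in r1.
have uv : u = v by apply/finset.set1P; apply: (supp_subP _ _ rv (existT _ u h)); rewrite E mem_head.
have := reduced_nf r; rewrite E /= => /and3P[h1 _ _].
by move: fr h1; rewrite -uv /front E /= eqxx at_vertex_syl => ->; rewrite eqxx.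
Qed.

Lemma centc_vertex v (P b : nat) : (forall n (h : H v), (1 <= n)%N -> h <> 1 ->
    (finite_card (centraliser h `&` gball (X v) n) <= P * n ^ b)%N) ->
  forall m x, (1 <= m)%N -> supp x \subset [set v]%SET -> x != 1 ->
    (centc [set v] x m <= P * m ^ b)%N.
Proof.
move=> Pb m x m1 xv x1; pose h := front v x.
have Ex : x = gp_in e h by exact: supp_vertex.
have h1 : h <> 1 by move=> E; move: x1; rewrite Ex E gp_in1 eqxx.
apply: leq_trans (Pb m h m1 h1); apply: (@card_injection _ _ _ _ (front v)).
- exact: centc_finite.
- apply: sub_finite_set (gball_finite (@X_generates v) m (X_gen v).1) => k [] //.
- move=> y [[yv ym] xy]; have Ey := supp_vertex yv; split.
    by apply: (@gp_in_inj v); rewrite !gp_inM -/h -Ex -Ey.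
  by rewrite /gball /= -len_in -Ey.
by move=> y z [[yv _] _] [[zv _] _] E; rewrite (supp_vertex yv) (supp_vertex zv) E.
Qed.

Definition superpolynomial U := forall K b : nat, exists L, forall m, (L <= m)%N ->
  (K * m ^ b <= ballc U m)%N.

Definition negligible_centralisers U := forall K, exists L, forall m x, (L <= m)%N ->
  supp x \subset U -> x != 1 -> (K * centc U x m <= ballc U m)%N.

Hypothesis X_centralisers : forall v, exists P b : nat, forall n (h : H v),
  (1 <= n)%N -> h <> 1 -> (finite_card (centraliser h `&` gball (X v) n) <= P * n ^ b)%N.

Lemma uniform_finite (I : finType) (Q : I -> nat -> Prop) :
  (forall i, exists L, forall m, (L <= m)%N -> Q i m) ->
  exists L, forall i m, (L <= m)%N -> Q i m.
Proof.
move=> /choice[L QL]; exists (\max_i L i) => i m Lm; apply: QL.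
exact: leq_trans (leq_bigmax i) Lm.
Qed.

Lemma parabolic_negligible U T K : irreducible U -> superpolynomial U -> T \proper U ->
  exists L, forall m, (L <= m)%N -> (K * ballc T m <= ballc U m)%N.
Proof.
move=> irr spU TU; have [M bM] := parabolic_sparse irr TU.
have [L UL] := spU (2 * K.+1 * ballc U (2 * K.+1 * M.+1))%N 0%N.
exists L => m /UL; rewrite expn0 muln1 => h1; have h2 := bM (2 * K.+1 * M.+1)%N m.
have h3 : (2 * K.+1 * M.+1 * ballc T m <=
    (2 * K.+1 * ballc U (2 * K.+1 * M.+1)) * M.+1 + M.+1 * ballc U m)%N.
  rewrite mulnC; apply: leq_trans h2 _; apply: leq_add; last by rewrite leq_mul2r leqnSn orbT.
  by rewrite mulnC mulnAC.
have {h3} : (2 * K.+1 * ballc T m <= ballc U m + ballc U m)%N.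
  rewrite -(leq_pmul2r (ltn0Sn M)) mulnAC; apply: leq_trans h3 _.
  by rewrite mulnDl leq_add ?leq_mul2r ?h1 ?orbT // mulnC.
by rewrite addnn -mul2n -mulnA leq_pmul2l //; apply: leq_trans; rewrite leq_mul2r leqnSn orbT.
Qed.

(** An element of a proper parabolic subgroup has its centraliser in another one, and these
    are sparse; by [centraliser_walls] the other elements have centralisers of linear
    growth, unless [U] is a single vertex. In this case the polynomial bound for the vertex
    group applies. All bounds are uniform in the element. *)
Lemma superpolynomial_negligible U : irreducible U -> superpolynomial U ->
  negligible_centralisers U.
Proof.
move=> irr spU K.
have [U2|U1] := ltnP 1 #|U|; last first.
  have [v Uv|U0] := pickP (mem U); last first.
    exists 0%N => m x _ xU /eqP; case; apply: supp_eq1.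
    apply: fintype.subset_trans xU _; apply/fintype.subsetP => v.
    by have U0v : (v \in U) = false := U0 v; rewrite U0v.
  have vU : v \in U by exact: Uv.
  have EU : U = [set v]%SET.
    by apply/esym/eqP; rewrite eqEcard finset.sub1set vU cards1.
  have [P [b Pb]] := X_centralisers v; have [L UL] := spU (K * P)%N b.
  exists L.+1 => m x Lm xU x1; apply: leq_trans (UL m (ltnW Lm)).
  rewrite -mulnA leq_mul2l EU (centc_vertex Pb) ?orbT //; first exact: leq_trans Lm.
  by rewrite -EU.
have [L1 H1] := spU (K * 6)%N 1%N.
have [L2 H2] : exists L, forall (T : {set V}) m, (L <= m)%N -> T \proper U ->
    (K * ballc T m <= ballc U m)%N.
  apply: uniform_finite => T; case: (boolP (T \proper U)) => TU; last by exists 0%N.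
  by have [L HL] := parabolic_negligible K irr spU TU; exists L => m /HL.
exists (maxn L1.+1 L2) => m x; rewrite geq_max => /andP[m1 m2] xU x1.
case: (centc_bound irr U2 xU x1) => [[T TU cT]|c].
  by apply: leq_trans (H2 T m m2 TU); rewrite leq_mul2l cT orbT.
apply: leq_trans (H1 m (ltnW m1)); rewrite -mulnA leq_mul2l; apply/orP; right.
apply: leq_trans (c m) _; rewrite expn1; have : (0 < m)%N by exact: leq_trans m1.
by clear; lia.
Qed.

(** * Commuting pairs *)

Local Notation allV := (finset.setT : {set V}).

(** Once the first element and the complementary projection of the second are fixed, there
    remain to be counted the elements of a centraliser in the factor. *)
Lemma factor_pairs U K : joined U (~: U) -> negligible_centralisers U ->
  exists L0, forall L n, (L0 <= L)%N -> (K * finite_card [set u : G * G | [/\ ball allV n u.1, ball allV n u.2,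
    (L <= len (prj U u.1))%N, (L <= len (prj U u.2))%N & commute (prj U u.1) (prj U u.2)]]
    <= ballc allV n ^ 2)%N.
Proof.
move=> UU neg; have [L0 HL] := neg K; exists L0.+1 => L n L0L.
set A := [set u | _].
have fB := @ball_finite allV n.
have fA : finite_set A.
  by apply: sub_finite_set (finite_setX fB fB) => u [].
rewrite expnS expn1; apply: card_fibers fA fB _ _ => [u []//|x xn].
have UV : U :|: ~: U = allV by exact: finset.setUCr.
have UU' : joined (~: U) U by exact: joined_sym.
have sub g : supp g \subset U :|: ~: U by rewrite UV finset.subsetT.
have sub' g : supp g \subset ~: U :|: U by rewrite finset.setUC.
have [xL|xL] := leqP L (len (prj U x)); last first.
  have -> : [set y | A (x, y)] = set0.
    by rewrite -subset0 => y [_ _ /=]; rewrite leqNgt xL.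
  by rewrite /finite_card fset_set0 cardfs0 muln0.
have x1 : prj U x != 1.
  by apply: contraTneq xL => ->; rewrite len1 -ltnNge; apply: leq_trans L0L.
pose Y := [set y | A (x, y)].
have fY : finite_set Y by apply: sub_finite_set (@ball_finite allV n) => y [].
rewrite -/Y (@card_slices _ Y (fun y => len (prj (~: U) y)) n) //; last first.
  by move=> y [_ [_ yn] _ _ _]; apply: leq_trans yn; rewrite (len_prj UU (sub y)) leq_addl.
rewrite -[in X in (_ <= X)%N]UV finset.setUC (ballc_joined _ UU') big_distrr /=.
apply: leq_sum => k _.
have kn : (k <= n)%N by rewrite -ltnS.
have fYk : finite_set (Y `&` [set y | len (prj (~: U) y) = k]).
  by apply: sub_finite_set fY => y [].
have [Lk|Lk] := leqP L0 (n - k); last first.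
  have -> : Y `&` [set y | len (prj (~: U) y) = k] = set0.
    rewrite -subset0 => y [[_ [_ yn] _ /= yL _] /= yk].
    move: yn; rewrite /= (len_prj UU (sub y)) yk; move: yL Lk kn L0L; clear; lia.
  by rewrite /finite_card fset_set0 cardfs0 muln0.
apply: (@leq_trans (K * (spherec (~: U) k * centc U (prj U x) (n - k)))%N).
  rewrite leq_mul2l; apply/orP; right; rewrite -card_setX; [|exact: sphere_finite|exact: centc_finite].
  apply: (@card_injection _ _ _ _ (fun y => (prj (~: U) y, prj U y))) => //.
  - by apply: finite_setX; [exact: sphere_finite|exact: centc_finite].
  - move=> y [[_ [_ yn] _ _ /= xy] /= yk]; split; first by split; [exact: supp_prj|].
    split=> //; split; first exact: supp_prj.
    by rewrite -(leq_add2l k) -{1}yk -(len_prj UU' (sub' y)) subnKC.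
  move=> y z _ _ [E1 E2].
  by rewrite (prj_mul UU (sub y)) (prj_mul UU (sub z)) E1 E2.
by rewrite mulnCA leq_mul2l HL ?supp_prj ?orbT.
Qed.

Lemma short_projection R l n : joined R (~: R) ->
  (finite_card (ball allV n `&` [set x | (len (prj R x) <= l)%N])
    <= ballc R l * ballc (~: R) n)%N.
Proof.
move=> RR; have sub g : supp g \subset R :|: ~: R by rewrite finset.setUCr finset.subsetT.
rewrite -card_setX; try exact: ball_finite.
apply: (@card_injection _ _ _ _ (fun x => (prj R x, prj (~: R) x))).
- by apply: sub_finite_set (@ball_finite allV n) => g [].
- by apply: finite_setX; exact: ball_finite.
- move=> x [[_ xn] xl]; split; split=> //=; try exact: supp_prj.
  by apply: leq_trans xn; rewrite (len_prj RR (sub x)) leq_addl.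
move=> x y _ _ [E1 E2].
by rewrite (prj_mul RR (sub x)) (prj_mul RR (sub y)) E1 E2.
Qed.

(** * The irreducible factors *)

Definition component u : {set V} := [set v | connect nadj u v].
Definition components : {set {set V}} := [set component u | u : V].

Definition nadj_closed (S : {set V}) := forall u v, u \in S -> nadj u v -> v \in S.

Lemma nadj_connect_sym : connect_sym nadj.
Proof. exact: sym_connect_sym nadj_sym. Qed.

Lemma component_irreducible U : U \in components -> irreducible U.
Proof.
move=> /imsetP[w _ ->] u; rewrite inE => wu v; rewrite inE.
by rewrite (same_connect nadj_connect_sym wu).
Qed.

Lemma component_eq U U' v : U \in components -> U' \in components ->
  v \in U -> v \in U' -> U = U'.
Proof.
move=> /component_irreducible iU /component_irreducible iU' vU vU'.
by apply/finset.setP => w; rewrite (iU v vU) (iU' v vU').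
Qed.

Lemma cover_components : finset.cover components = finset.setT.
Proof.
apply/finset.setP => v; rewrite finset.in_setT; apply/finset.bigcupP.
by exists (component v); [apply: imset_f|rewrite inE connect0].
Qed.

Lemma nadj_closed_cover (P : {set {set V}}) : P \subset components -> nadj_closed (finset.cover P).
Proof.
move=> /fintype.subsetP PC u v /finset.bigcupP[U UP uU] uv; apply/finset.bigcupP; exists U => //.
exact: irreducible_nadj (component_irreducible (PC U UP)) uU uv.
Qed.

Lemma nadj_closed_joined T T' : nadj_closed T -> T \subset ~: T' -> joined T T'.
Proof.
move=> cT /fintype.subsetP dTT' u v uT vT'; have vT : v \notin T.
  by apply/negP => /dTT'; rewrite finset.in_setC vT'.
have uv : u != v by apply: contraNneq vT => <-.
by apply: contraR vT => nuv; apply: cT uT _; rewrite /nadj /= uv nuv.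
Qed.

Lemma nadj_closed_joinedC T : nadj_closed T -> joined T (~: T).
Proof. by move=> /nadj_closed_joined; apply; rewrite finset.setCK. Qed.

Lemma cover_disjoint (P Q : {set {set V}}) : P \subset components -> Q \subset components ->
  P \subset ~: Q -> finset.cover P \subset ~: finset.cover Q.
Proof.
move=> /fintype.subsetP PC /fintype.subsetP QC /fintype.subsetP dPQ.
apply/fintype.subsetP => v /finset.bigcupP[U UP vU].
rewrite finset.in_setC; apply/negP => /finset.bigcupP[U' U'Q vU'].
have E := component_eq (PC _ UP) (QC _ U'Q) vU vU'.
by have := dPQ _ UP; rewrite finset.in_setC E U'Q.
Qed.

(** The left side is at most the right side for [T] and for its complement; and both sides
    add up to the length of [g]. *)
Lemma len_prj_sum T g : joined T (~: T) ->
  len (prj T g) = (\sum_(a <- nf g | tag a \in T) syl_len a)%N.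
Proof.
move=> TT; have le S : (len (prj S g) <= \sum_(a <- nf g | tag a \in S) syl_len a)%N.
  by rewrite -big_filter; exact: cost_gpw_le seminorm_syl_len.
apply/eqP; rewrite eqn_leq le /= -(leq_add2r (len (prj (~: T) g))).
rewrite -(len_prj TT); last by rewrite finset.setUCr finset.subsetT.
rewrite [X in (_ <= X)%N]/len [X in (_ <= X)%N]/cost.
rewrite [X in (_ <= X)%N](bigID (fun a => tag a \in T)) /=.
rewrite leq_add2l; apply: leq_trans (le _) _.
by rewrite (eq_bigl (fun a => tag a \notin T)) // => a; rewrite finset.in_setC.
Qed.

Lemma len_prj_cover (P : {set {set V}}) g : P \subset components ->
  (len (prj (finset.cover P) g) <= \sum_(U in P) len (prj U g))%N.
Proof.
move=> PC; rewrite len_prj_sum; last exact/nadj_closed_joinedC/nadj_closed_cover.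
have -> : (\sum_(U in P) len (prj U g) =
    \sum_(U in P) \sum_(a <- nf g | tag a \in U) syl_len a)%N.
  apply: eq_bigr => U UP; apply/len_prj_sum/nadj_closed_joinedC => u v uU.
  exact: irreducible_nadj (component_irreducible (fintype.subsetP PC U UP)) uU.
rewrite (exchange_big_dep xpredT) //= big_mkcond /=; apply: leq_sum => a _.
case: ifP => // /finset.bigcupP[U UP aU].
by rewrite (bigD1 U) /= ?UP ?aU // leq_addr.
Qed.

Section RealGrowth.
Local Open Scope ring_scope.
Variable R : realType.
Implicit Types (mu : R).

Lemma slow_cover mu (P : {set {set V}}) : 1 < mu -> P \subset components ->
  (forall U, U \in P -> slow mu (ballc U)) -> slow mu (ballc (finset.cover P)).
Proof.
move=> mu1; have [n] := ubnP #|P|; elim: n P => // n IHn P; rewrite ltnS => Pn PC slowP.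
have [P0|[U UP]] := finset.set_0Vmem P.
  exists 1, 1; split=> // k; rewrite expr1n mulr1 lern1.
  have <- : finite_card [set (1%g : G)] = 1%N by rewrite /finite_card fset_set1 cardfs1.
  apply: card_subset; first exact: finite_set1.
  by move=> g [+ _]; rewrite P0 /finset.cover big_set0 => /supp_eq1.
have PC' : P :\ U \subset components.
  by apply: fintype.subset_trans PC; exact: finset.subD1set.
have U1 : [set U]%SET \subset components.
  by rewrite finset.sub1set (fintype.subsetP PC).
have EP : finset.cover P = (U :|: finset.cover (P :\ U))%SET.
  by rewrite /finset.cover -{1}(finset.setD1K UP) finset.bigcup_setU finset.big_set1.
have jU : joined U (finset.cover (P :\ U)).
  have EU : U = finset.cover [set U]%SET by rewrite /finset.cover finset.big_set1.
  rewrite {1}EU; apply: nadj_closed_joined; first exact: nadj_closed_cover.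
  apply: cover_disjoint => //.
  by rewrite finset.sub1set finset.in_setC finset.in_setD1 eqxx.
rewrite EP; apply: (slow_convolution (s := spherec U) (slowP U UP)
  (IHn (P :\ U) _ PC' _)) => [||k|k].
- by apply: leq_trans Pn; rewrite [X in (_ < X)%N](cardsD1 U) UP.
- by move=> U' /finset.setD1P[_]; exact: slowP.
- apply: card_subset (@ball_finite _ _) _ => g [gU gk]; split=> //.
  by rewrite gk.
- exact: ballc_joined.
Qed.

(** By submultiplicativity, all other factors have a growth rate less than [mu]. *)
Definition fast mu : {set {set V}} :=
  [set U in components | `[< forall q : nat, mu ^+ q <= (ballc U q)%:R >]].

Lemma slow_components mu U : 1 < mu -> U \in components -> U \notin fast mu ->
  slow mu (ballc U).
Proof.
move=> mu1 UC; rewrite inE UC /= => /asboolPn/existsNP[q /negP]; rewrite -ltNge => Uq.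
apply: slow_submultiplicative mu1 Uq => [n|m n|m n]; first exact: ballc_gt0.
  exact: ballcM.
exact: ballc_mono.
Qed.

Lemma fast_superpolynomial mu U : 1 < mu -> U \in fast mu -> superpolynomial U.
Proof.
move=> mu1; rewrite inE => /andP[_ /asboolP Umu] K b.
have [L HL] := expr_superpolynomial K b mu1; exists L => m /HL /le_trans/(_ (Umu m)).
by rewrite ler_nat.
Qed.

(** Split the fast factors into two sets, and let each of the two products, together with
    the slow factors, compete for the elements of the ball: one of them must lose. *)
Lemma fast_split mu (I : {set {set V}}) (K : nat) : 1 < mu -> fast mu != finset.set0 ->
  I \subset fast mu -> exists L, forall n, (L <= n)%N ->
    (K * minn (ballc (~: finset.cover (fast mu :\: I)) n) (ballc (~: finset.cover I) n)
      <= ballc allV n)%N.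
Proof.
move=> mu1 fast0 If; set J := fast mu :\: I; set Q := components :\: fast mu.
have fC : fast mu \subset components by apply/fintype.subsetP => U; rewrite inE => /andP[].
have IC : I \subset components by exact: fintype.subset_trans fC.
have JC : J \subset components by apply: fintype.subset_trans fC; exact: finset.subsetDl.
have QC : Q \subset components by exact: finset.subsetDl.
set A := finset.cover I; set B := finset.cover J; set S := finset.cover Q.
have jQI : Q \subset ~: I.
  by rewrite -finset.setCS finset.setCK (fintype.subset_trans If) // finset.setCD finset.subsetUr.
have jQJ : Q \subset ~: J.
  rewrite -finset.setCS finset.setCK finset.setCD; apply: fintype.subset_trans (finset.subsetUr _ _).
  exact: finset.subsetDl.
have jIJ : I \subset ~: J by rewrite finset.setCD finset.subsetUr.
have SA : joined S A by apply: nadj_closed_joined (nadj_closed_cover QC) _; exact: cover_disjoint.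
have SB : joined S B by apply: nadj_closed_joined (nadj_closed_cover QC) _; exact: cover_disjoint.
have AB : joined A B by apply: nadj_closed_joined (nadj_closed_cover IC) _; exact: cover_disjoint.
have disj T T' v : joined T T' -> v \in T -> v \in T' = false.
  by move=> TT' vT; apply/negP => /(joined_disjoint TT' vT).
have memE v : [|| v \in A, v \in B | v \in S].
  have /finset.bigcupP[U UC vU] : v \in finset.cover components.
    by rewrite cover_components finset.in_setT.
  case UI: (U \in I); first by apply/or3P/Or31/finset.bigcupP; exists U.
  case Uf: (U \in fast mu).
    by apply/or3P/Or32/finset.bigcupP; exists U; rewrite // finset.in_setD UI Uf.
  by apply/or3P/Or33/finset.bigcupP; exists U; rewrite // finset.in_setD Uf UC.
have CB : ~: B = (S :|: A)%SET.
  apply/finset.setP => v; rewrite finset.in_setC finset.in_setU; have := memE v.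
  case vA: (v \in A); first by rewrite (disj _ _ _ AB vA) orbT.
  by case vS: (v \in S); rewrite ?(disj _ _ _ SB vS) //= orbF => ->.
have CA : ~: A = (S :|: B)%SET.
  apply/finset.setP => v; rewrite finset.in_setC finset.in_setU; have := memE v.
  case vA: (v \in A) => /=; last by rewrite orbC => ->.
  have /negbTE -> : v \notin B by rewrite (disj _ _ _ AB vA).
  by rewrite (disj _ _ _ (joined_sym SA) vA).
have [nu [C [nu1 numu C0 hS]]] : slow mu (ballc S).
  apply: slow_cover => // U; rewrite finset.in_setD => /andP[nf UC].
  exact: slow_components.
have spb T k : (spherec T k <= ballc T k)%N.
  by apply: card_subset (@ball_finite _ _) _ => g [gT gk]; split=> //; rewrite gk.
have prod T n : nadj_closed T -> (\sum_(k < n.+1) spherec T k * ballc (~: T) (n - k) <= ballc allV n)%N.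
  by move=> cT; rewrite -ballc_joined ?finset.setUCr //; exact: nadj_closed_joinedC.
apply: (growth_balance (A := ballc A) (B := ballc B) (a := spherec A) (b := spherec B)
  (s := spherec S) nu1 numu C0).
- exact: spherecE.
- exact: spherecE.
- move=> k; have [U Uf] := finset.set0Pn _ fast0.
  have Uk : mu ^+ k <= (ballc U k)%:R.
    by move: Uf; rewrite inE => /andP[_ /asboolP].
  apply: le_trans Uk _; rewrite ler_nat; case: (boolP (U \in I)) => UI.
    apply: leq_trans (leq_addr _ _); apply: ballc_sub; exact: finset.bigcup_sup.
  apply: leq_trans (leq_addl _ _); apply: ballc_sub; apply: finset.bigcup_sup.
  by rewrite finset.in_setD UI.
- by move=> k; apply: le_trans (hS k); rewrite ler_nat.
- by move=> n; rewrite CB; exact: ballc_joined.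
- by move=> n; rewrite CA; exact: ballc_joined.
- by move=> n; exact: ballc_gt0.
- by move=> n; exact: ballc_gt0.
- by move=> m n; exact: ballcM.
- by move=> m n; exact: ballcM.
- by move=> n; apply: prod; exact: nadj_closed_cover.
- by move=> n; apply: prod; exact: nadj_closed_cover.
Qed.

End RealGrowth.

(** * Almost no pairs commute *)

Lemma sum_share (I : eqType) (r : seq I) (f : I -> nat) (K B : nat) :
  (forall i, i \in r -> (K * (size r).+1 * f i <= B)%N) -> (K * \sum_(i <- r) f i <= B)%N.
Proof.
move=> fB; rewrite -(leq_pmul2l (ltn0Sn (size r))) mulnCA mulnA big_distrr /=.
apply: (@leq_trans (\sum_(i <- r) B)%N).
  by rewrite big_seq [X in (_ <= X)%N]big_seq; apply: leq_sum => i /fB.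
by rewrite big_const_seq count_predT iter_addn_0 mulnC leq_mul2r leqnSn orbT.
Qed.

Definition commuting_pairs n : set (G * G) :=
  [set u | [/\ ball allV n u.1, ball allV n u.2 & commute u.1 u.2]].

(** In a commuting pair of elements of a large ball, few have long projections to the same
    fast factor, as centralisers are negligible there. Otherwise the fast factors
    split into those to which only the first element may have a long projection and the
    others, and the pairs of this kind are few by the competition of these two products. *)
Lemma commuting_pairs_negligible (R : realType) (mu : R) (K : nat) : (1 < mu)%R ->
  fast mu != finset.set0 -> exists L, forall n, (L <= n)%N ->
    (K * finite_card (commuting_pairs n) <= ballc allV n ^ 2)%N.
Proof.
move=> mu1 fast0; set F := fast mu.
have FC : F \subset components by apply/fintype.subsetP => U; rewrite inE => /andP[].
pose P U l n := [set u : G * G | [/\ ball allV n u.1, ball allV n u.2,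
    (l <= len (prj U u.1))%N, (l <= len (prj U u.2))%N & commute (prj U u.1) (prj U u.2)]].
have closedU U : U \in components -> nadj_closed U.
  move=> /component_irreducible irr u v uU; exact: irreducible_nadj irr uU.
have [l Hl] : exists l, forall U m, (l <= m)%N -> U \in F -> forall n,
    (2 * K * (size (enum F)).+1 * finite_card (P U m n) <= ballc allV n ^ 2)%N.
  apply: uniform_finite => U; case: (boolP (U \in F)) => UF; last by exists 0%N.
  have UC := fintype.subsetP FC _ UF.
  have neg := superpolynomial_negligible (component_irreducible UC) (fast_superpolynomial mu1 UF).
  have [L HL] := factor_pairs (2 * K * (size (enum F)).+1) (nadj_closed_joinedC (closedU _ UC)) neg.
  by exists L => m Lm _ n; exact: HL.
pose r := enum (powerset F); pose C := ballc allV (#|F| * l).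
have [L HL] : exists L, forall (I : {set {set V}}) n, (L <= n)%N -> I \subset F ->
    (2 * K * (size r).+1 * C ^ 2 * minn (ballc (~: finset.cover (F :\: I)) n)
      (ballc (~: finset.cover I) n) <= ballc allV n)%N.
  apply: uniform_finite => I; case: (boolP (I \subset F)) => IF; last by exists 0%N.
  by have [L HL] := fast_split (2 * K * (size r).+1 * C ^ 2) mu1 fast0 IF; exists L => m /HL.
(* The constants [2 * K * (size _).+1] let all pairs of each kind sum up to half of what
   is allowed. *)
exists L => n Ln; set N := ballc allV n.
have fB := @ball_finite allV n.
pose short (S : {set {set V}}) := ball allV n `&` [set x | (len (prj (finset.cover S) x) <= #|F| * l)%N].
pose Q (I : {set {set V}}) : set (G * G) := short (F :\: I) `*` short I.
have fP U : finite_set (P U l n) by apply: sub_finite_set (finite_setX fB fB) => u [].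
have fQ I : finite_set (Q I).
  by apply: finite_setX; apply: sub_finite_set (@ball_finite allV n) => g [].
have shortP (S : {set {set V}}) x : S \subset F -> ball allV n x ->
    (forall U, U \in S -> (len (prj U x) < l)%N) -> short S x.
  move=> SF xn Sx; split=> //; have SC := fintype.subset_trans SF FC.
  apply: leq_trans (len_prj_cover x SC) _.
  apply: (@leq_trans (\sum_(U in S) l)%N); first by apply: leq_sum => U /Sx/ltnW.
  by rewrite sum_nat_const leq_mul2r subset_leq_card ?orbT.
pose E1 := [set u | exists2 U, U \in enum F & P U l n u].
pose E2 := [set u | exists2 I, I \in r & Q I u].
have fE1 : finite_set E1.
  apply: (@sub_finite_set _ _ (\bigcup_(U in [set` enum F]) P U l n)).
    by move=> u [U UF Pu]; exists U.
  by apply: bigcup_finite => // U _; exact: fP.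
have fE2 : finite_set E2.
  apply: (@sub_finite_set _ _ (\bigcup_(I in [set` r]) Q I)).
    by move=> u [I Ir Qu]; exists I.
  by apply: bigcup_finite => // I _; exact: fQ.
have cover12 : commuting_pairs n `<=` E1 `|` E2.
  move=> [x y] [/= xn yn xy].
  case: (pselect (E1 (x, y))) => nE1; [by left|right].
  exists [set U in F | (l <= len (prj U x))%N]%SET.
    by rewrite mem_enum powersetE; apply/fintype.subsetP => U; rewrite inE => /andP[].
  split; apply: shortP => //=.
  - exact: finset.subsetDl.
  - by move=> U; rewrite !inE => /andP[+ UF]; rewrite UF /= -ltnNge.
  - by apply/fintype.subsetP => U; rewrite inE => /andP[].
  move=> U; rewrite inE => /andP[UF xU]; rewrite ltnNge; apply/negP => yU.
  apply: nE1; exists U; first by rewrite mem_enum.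
  have UU := nadj_closed_joinedC (closedU _ (fintype.subsetP FC _ UF)).
  have sub g : supp g \subset U :|: ~: U by rewrite finset.setUCr finset.subsetT.
  by split=> //=; exact: prj_commute UU (sub x) (sub y) xy.
have le12 : (finite_card (commuting_pairs n) <= finite_card E1 + finite_card E2)%N.
  apply: leq_trans (card_setU fE1 fE2); apply: card_subset cover12.
  by rewrite finite_setU.
have le1 : (2 * K * finite_card E1 <= N ^ 2)%N.
  apply: (@leq_trans (2 * K * \sum_(U <- enum F) finite_card (P U l n))%N).
    by rewrite leq_mul2l card_cover ?orbT.
  by apply: sum_share => U; rewrite mem_enum => UF; exact: Hl.
have le2 : (2 * K * finite_card E2 <= N ^ 2)%N.
  apply: (@leq_trans (2 * K * \sum_(I <- r) finite_card (Q I))%N).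
    by rewrite leq_mul2l card_cover ?orbT.
  apply: sum_share => I; rewrite mem_enum powersetE => IF.
  set p := ballc (~: finset.cover (F :\: I)) n; set q := ballc (~: finset.cover I) n.
  have pN : (p <= N)%N by apply: ballc_sub; exact: finset.subsetT.
  have qN : (q <= N)%N by apply: ballc_sub; exact: finset.subsetT.
  have cardshort (S : {set {set V}}) : S \subset F ->
      (finite_card (short S) <= C * ballc (~: finset.cover S) n)%N.
    move=> SF; have SC := fintype.subset_trans SF FC.
    apply: leq_trans (short_projection _ _ (nadj_closed_joinedC (nadj_closed_cover SC))) _.
    by rewrite leq_mul2r ballc_sub ?orbT //; exact: finset.subsetT.
  have cQ : (finite_card (Q I) <= (C * p) * (C * q))%N.
    rewrite card_setX; try by apply: sub_finite_set (@ball_finite allV n) => g [].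
    by apply: leq_mul; apply: cardshort => //; exact: finset.subsetDl.
  have pq : (p * q <= N * minn p q)%N.
    case: (leqP p q) => pq; first by rewrite mulnC leq_mul2r qN orbT.
    by rewrite leq_mul2r pN orbT.
  have := HL I n Ln IF; rewrite -/p -/q -/N => HI.
  apply: (@leq_trans (2 * K * (size r).+1 * (C ^ 2 * (N * minn p q)))%N).
    rewrite leq_mul2l; apply/orP; right; apply: leq_trans cQ _.
    by rewrite mulnACA mulnn leq_mul2l pq orbT.
  by rewrite mulnA mulnCA -[X in (_ <= X)%N]mulnn leq_mul2l HI orbT.
rewrite -(leq_pmul2l (ltn0Sn 1)) mulnA [X in (_ <= X)%N]mul2n -addnn.
by apply: leq_trans (leq_add le1 le2); rewrite -mulnDr leq_mul2l le12 orbT.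
Qed.

Lemma exponential_ballc (R : realType) : exponential_growth R G ->
  exists (c : R) (D n0 : nat), (1 < c)%R /\
    forall n, (n0 <= n)%N -> (c ^+ n <= (ballc allV (D.+1 * n))%:R)%R.
Proof.
move=> [Y [[fY genY] growY]].
have [D HD] : exists D, forall y, Y y -> (len y <= D)%N.
  exists (\sum_(y <- fset_set Y) len y)%N => y Yy.
  by rewrite (big_fsetD1 y) /= ?leq_addr // in_fset_set // in_setE.
have sub n : gball Y n `<=` ball allV (D.+1 * n).
  move=> g gn; split; first exact: finset.subsetT.
  have [[w [Yw Ew] sw] _] := word_lengthP genY g.
  apply: (@leq_trans (D.+1 * size w)); last by rewrite leq_mul2l sw.
  rewrite -Ew; elim: w Yw {Ew sw} => [|y w IHw] Yw; first by rewrite big_nil len1.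
  rewrite big_cons mulnS; apply: leq_trans (lenM _ _) _; apply: leq_add; last first.
    by apply: IHw => z zw; apply: Yw; rewrite inE zw orbT.
  by apply: leqW; case: (Yw y (mem_head _ _)) => /HD //; rewrite lenV.
have bY n : (finite_card (gball Y n) <= ballc allV (D.+1 * n))%N.
  by apply: card_subset (@ball_finite _ _) _; exact: sub.
pose u n : R := (ln (finite_card (gball Y n))%:R / n%:R)%R.
move: growY; rewrite /limn_einf oppe_gt0 => /ereal_inf_lt[_ [A [n0 _ n0A] <-]].
set S := ereal_sup _ => S0.
have [c c0 Hc] : exists2 c : R, (0 < c)%R & forall n, (n0 <= n)%N -> (c <= u n)%R.
  have up n : (n0 <= n)%N -> (- (u n)%:E <= S)%E.
    by move=> n0n; apply: ereal_sup_ubound; exists n => //; exact: n0A.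
  move: S0 up; case: S => [r| |] //=; rewrite ?lte_fin => r0 up.
    exists (- r)%R; first by rewrite oppr_gt0.
    by move=> n /up; rewrite lee_fin lerNl.
  by have := up n0 (leqnn _); rewrite leeNy_eq.
exists (expR c), D, n0.+1; split=> [|n n0n]; first by rewrite expR_gt1.
apply: le_trans (_ : ((finite_card (gball Y n))%:R <= _)%R); last by rewrite ler_nat.
have n_gt0 : (0 < n%:R :> R)%R by rewrite ltr0n; exact: leq_trans n0n.
have b0 : (0 < (finite_card (gball Y n))%:R :> R)%R.
  have := Hc n (ltnW n0n); rewrite ler_pdivlMr // => h; rewrite ltNge; apply/negP => b0.
  by move: h; rewrite ln0 // leNgt mulr_gt0.
rewrite -expRM_natr -[leRHS](lnK b0) ler_expR -ler_pdivlMr //.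
exact: Hc (ltnW n0n).
Qed.

(** If all factors had slow growth, then so would their product. *)
Lemma exponential_fast (R : realType) : exponential_growth R G ->
  exists2 mu : R, (1 < mu)%R & fast mu != finset.set0.
Proof.
move=> /exponential_ballc[c [D [n0 [c1 Hc]]]].
(* Balls of radius [D.+1 * n] have at least [c ^+ n] elements. *)
have [mu mu1 Emu] := root_exists (ltW c1) (ltn0Sn D).
have {}mu1 : (1 < mu)%R.
  rewrite lt_neqAle mu1 andbT; apply: contraTneq c1 => mu1'.
  by rewrite -Emu -mu1' expr1n ltxx.
exists mu => //; apply/negP => /eqP fast0.
have [nu [C [nu1 numu C0 HC]]] : slow mu (ballc allV).
  rewrite -cover_components; apply: slow_cover => // U UC.
  by apply: slow_components => //; rewrite fast0 finset.in_set0.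
have nu0 : (0 < nu)%R by exact: lt_le_trans nu1.
have q1 : (1 < mu / nu)%R by rewrite ltr_pdivlMr // mul1r.
have [m Hm] := expr_unbounded (C + 1)%R q1.
pose n := maxn n0 m.
have := Hc n (leq_maxl _ _); rewrite -Emu -exprM => /le_trans/(_ (HC _)).
rewrite -ler_pdivrMr ?exprn_gt0 // -expr_div_n leNgt => /negP; apply.
apply: (@lt_le_trans _ _ (C + 1)%R); first by rewrite ltrDl.
apply: Hm; apply: leq_trans (leq_maxr n0 m) _; exact: leq_pmull.
Qed.

Lemma degree_commutativity_eq0 (R : realType) : exponential_growth R G ->
  degree_commutativity R (gp_gens e X) = 0%E.
Proof.
move=> /exponential_fast[mu mu1 fast0].
pose u n : R := ((finite_card (commuting_pairs n))%:R / (ballc allV n ^ 2)%N%:R)%R.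
rewrite /degree_commutativity (_ : (fun n => _) = EFin \o u); last first.
  apply/funext => n; rewrite /= /u gball_ball.
  rewrite (_ : [set xy : G * G | _] = commuting_pairs n) //.
  apply/seteqP; split=> -[x y] /= [xn yn] xy; split=> //=.
    exact/commgP/eqP.
  exact/eqP/commgP.
suff u0 : u @ \oo --> (0%R : R).
  have cu : (EFin \o u) x @[x --> \oo] --> 0%:E by apply: cvg_EFin => //; exact: nearW.
  by have [_ ->] := cvg_limn_einf_sup cu.
apply/cvgrPdist_le => eps eps0.
have [m Hm] : exists m : nat, (eps^-1 <= m.+1%:R :> R)%R.
  by exists (Num.truncn (eps^-1)%R); rewrite ltW // truncnS_gt.
have [L HL] := commuting_pairs_negligible m.+1 mu1 fast0.
exists L => // n /= Ln; rewrite sub0r normrN ger0_norm ?divr_ge0 //.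
have N0 : (0 < (ballc allV n ^ 2)%N%:R :> R)%R by rewrite ltr0n expn_gt0 ballc_gt0.
rewrite /u ler_pdivrMr // -ler_pdivrMl // mulrC.
apply: (@le_trans _ _ ((finite_card (commuting_pairs n))%:R * m.+1%:R)%R).
  by rewrite ler_wpM2l.
by rewrite -natrM ler_nat mulnC HL.
Qed.

End Words.

Theorem theorem6 (R : realType) (V : finType) (e : rel V)
    (e_sym : symmetric e) (e_irrefl : irreflexive e)
    (H : V -> groupType) (X : forall v : V, set (H v))
    (H_nontrivial : forall v : V, exists g : H v, g <> 1%g)
    (HX : forall v : V, rational_small_centralisers R (X v))
    (G_exp : exponential_growth R (graph_product e H)) :
  degree_commutativity R (gp_gens e X) = 0%E.
Proof.
apply: degree_commutativity_eq0 => // v; first by case: (HX v).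
case: (HX v) => _ _ [P [b [_ _ HP]]]; exists P, b => n h n1 h1.
exact: HP.
Qed.
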